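(* Let $\Omega\subseteq\mathbb{R}^p$ be a connected open set and let $C:\Omega\to\mathbb{R}^{n\times m}$, $a:\Omega\to\Delta^{n-1}\cap\mathbb{R}_{>0}^n$, $b:\Omega\to\Delta^{m-1}\cap\mathbb{R}_{>0}^m$, $\epsilon:\Omega\to\mathbb{R}_{>0}$ and $x_0:\Omega\to\mathbb{R}^n$ all be twice continuously differentiable on $\Omega$. For $\theta\in\Omega$, let $\hat P(\theta)$ be the unique solution of the entropic optimal transport problem, let $x_{k+1}(\theta)=F(x_k(\theta),\theta)$, $k\in\mathbb{N}$, be the Sinkhorn--Knopp iterates initialized at $x_0(\theta)$, let $\bar x(\theta)$ be the limit of $(x_k(\theta))_{k\in\mathbb{N}}$, and let $P_k(\theta)=P(x_k(\theta),\theta)$ (with $F$, $P$ and the problem defined in the context). Then: (1) The optimal coupling matrix $\hat P$ is continuously differentiable on $\Omega$, and its derivative $\frac{d\hat P(\theta)}{d\theta}\in\mathbb{R}^{n\times m\times p}$ is given by $$\frac{d\hat P(\theta)}{d\theta}=\frac{\partial P(\bar x(\theta),\theta)}{\partial x}\,(I-A(\theta))^{\sharp}\,B(\theta)+\frac{\partial P(\bar x(\theta),\theta)}{\partial\theta},$$ where $[A(\theta)\;\;B(\theta)]=J_F(\bar x(\theta),\theta)$, i.e. $A(\theta)\in\mathbb{R}^{n\times n}$ and $B(\theta)\in\mathbb{R}^{n\times p}$ are the partial derivatives of $F$ with respect to $x$ and $\theta$ at $(\bar x(\theta),\theta)$, and $\sharp$ denotes the spectral pseudo-inverse of a diagonalizable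 matrix. (2) $P_k$ is continuously differentiable on $\Omega$ for all $k\in\mathbb{N}$, and the sequence of derivatives $\left(\frac{dP_k}{d\theta}\right)_{k\in\mathbb{N}}$ converges at a linear rate, locally uniformly in $\theta$. In particular, for all $\theta\in\Omega$, $$\lim_{k\to+\infty}\frac{dP_k}{d\theta}(\theta)=\frac{d\hat P}{d\theta}(\theta).$$
   Context: $\Delta^{n-1}$ is the set of vectors of $\mathbb{R}^n$ with nonnegative entries summing to $1$; $\mathbb{R}_{>0}$ denotes the positive reals; $1_n$ is the all-ones vector of $\mathbb{R}^n$. Functions such as $\log$ and $\exp$, and divisions and powers of vectors, are applied entrywise. Entropic optimal transport: for $\theta\in\Omega$, $$\hat P(\theta)=\arg\min_{P\in U(\theta)}\ \langle P,C(\theta)\rangle-\epsilon(\theta)\,\mathrm{Ent}(P),$$ where $\langle P,P'\rangle=\sum_{i,j}P_{i,j}P'_{i,j}$, $U(\theta)=\{P\in\mathbb{R}_{\ge0}^{n\times m}: P1_m=a(\theta),\ P^\top 1_n=b(\theta)\}$, and $\mathrm{Ent}(P)=-\sum_{i,j}P_{i,j}(\log P_{i,j}-1)$ with the convention $0\log 0=0$. The minimizer exists and is unique. Set $K_{i,j}(\theta)=\exp(-C_{i,j}(\theta)/\epsilon(\theta))$. For $(x,\theta)\in\mathbb{R}^n\times\Omega$, $$F(x,\theta)=\log(a(\theta))-\log\left(K(\theta)\left(\frac{b(\theta)}{K(\theta)^Te^x}\right)\right)\in\mathbb{R}^n,\qquad P(x,\theta)=\mathrm{diag}(e^x)\,K(\theta)\,\mathrm{diag}\left(\frac{b(\theta)}{K(\theta)^Te^x}\right)\in\mathbb{R}^{n\times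 m}.$$ $J_F(x,\theta)=\left[\frac{\partial F}{\partial x}(x,\theta)\ \ \frac{\partial F}{\partial\theta}(x,\theta)\right]$ is the total derivative. The partial derivatives of $P$ are third-order tensors $\frac{\partial P}{\partial x}\in\mathbb{R}^{n\times m\times n}$, $\frac{\partial P}{\partial\theta}\in\mathbb{R}^{n\times m\times p}$ (the last index is the differentiation index); for $M\in\mathbb{R}^{n\times q}$, the product $\frac{\partial P}{\partial x}M\in\mathbb{R}^{n\times m\times q}$ contracts the last index of the tensor with the row index of $M$, as in the chain rule. Spectral pseudo-inverse: if $M\in\mathbb{R}^{n\times n}$ is diagonalizable, $M=QDQ^{-1}$ with $Q$ invertible and $D$ diagonal, then $M^\sharp=QD^\dagger Q^{-1}$, where $D^\dagger$ is diagonal with $(D^\dagger)_{ii}=1/D_{ii}$ if $D_{ii}\neq0$ and $0$ otherwise. ''Converges at a linear rate, locally uniformly in $\theta$'' means: every $\theta_0\in\Omega$ has a neighborhood $V\subseteq\Omega$ for which there are constants $c>0$ and $r\in(0,1)$ such that for all $\theta\in V$ and $k\in\mathbb{N}$ the distance to the limit at $\theta$ is at most $c\,r^k$. *)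

(* Defs.v *)
From HB Require Import structures.
From mathcomp Require Import all_boot all_order all_algebra.
From mathcomp Require Import all_classical all_reals all_analysis.

Set Implicit Arguments.
Unset Strict Implicit.
Unset Printing Implicit Defensive.

Import Order.TTheory GRing.Theory Num.Theory.
Import numFieldNormedType.Exports.

Local Open Scope classical_set_scope.
Local Open Scope ring_scope.

(* Continuity of the Frechet differential is required direction by direction;
   on finite-dimensional [V] this is continuity in operator norm.  Only the
   values of [f] on the open set [O] matter, since ['d f x] is local. *)
Definition C1_on (R : realType) (V W : normedModType R) (O : set V)
    (f : V -> W) : Prop :=
  (forall x, O x -> differentiable f x) /\
  (forall v x, O x -> {for x, continuous (fun y => 'd f y v)}).

Definition C2_on (R : realType) (V W : normedModType R) (O : set V)
    (f : V -> W) : Prop :=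
  C1_on O f /\ (forall v, C1_on O (fun y => 'd f y v)).

(* [T : tensor3 R n m q] has entries T_{i,j,l} := T 0 l i j: the last index
   [l] selects an n x m slice. *)
Notation tensor3 R n m q := ('rV['M[R]_(n, m)]_q).

(* (d f_{i,j} / d x_l)_{i,j,l} *)
Definition derivative_tensor (R : realType) n m q
    (f : 'cV[R]_q -> 'M[R]_(n, m)) (x : 'cV[R]_q) : tensor3 R n m q :=
  \row_(l < q) 'd f x (delta_mx l 0).

(* (d f_i / d x_l)_{i,l}: column-vector convention, transposed with respect to
   the library's ['J f x], which acts on row vectors. *)
Definition jacobian_matrix (R : realType) n q
    (f : 'cV[R]_q -> 'cV[R]_n) (x : 'cV[R]_q) : 'M[R]_(n, q) :=
  \matrix_(i < n, l < q) ('d f x (delta_mx l 0) : 'cV[R]_n) i 0.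

(* (T M)_{i,j,l} = \sum_k T_{i,j,k} M_{k,l} *)
Definition tensor_mul (R : realType) n m q r
    (T : tensor3 R n m q) (M : 'M[R]_(q, r)) : tensor3 R n m r :=
  \row_(l < r) \sum_(k < q) M k l *: T 0 k.

(* maximum of the absolute values of the entries *)
Definition tensor_norm (R : realType) n m q (T : tensor3 R n m q) : R :=
  \big[Num.max/0]_(l < q) `|T 0 l|.

Definition linear_rate_loc_unif (R : realType) n m q (V : normedModType R)
    (O : set V) (T : nat -> V -> tensor3 R n m q)
    (L : V -> tensor3 R n m q) : Prop :=
  forall v0, O v0 -> exists N : set V, [/\ nbhs v0 N, N `<=` O &
    exists c r : R, [/\ 0 < c, 0 < r, r < 1 &
      forall v k, N v -> tensor_norm (T k v - L v) <= c * r ^+ k]].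

(* Diagonalization over [R]; as 0^-1 = 0, the entrywise inverse of the diagonal
   is exactly the diagonal of the pseudo-inverse. *)
Definition is_spectral_pinv (R : realType) n (M N : 'M[R]_n) : Prop :=
  exists (Q : 'M[R]_n) (d : 'rV[R]_n),
    [/\ Q \in unitmx, M = Q *m diag_mx d *m invmx Q &
        N = Q *m diag_mx (map_mx GRing.inv d) *m invmx Q].

(* When [M] is diagonalizable, [N] in [is_spectral_pinv M N] does not depend on
   the choice of [Q] and [d]; the value is 0 otherwise. *)
Definition spectral_pinv (R : realType) n (M : 'M[R]_n) : 'M[R]_n :=
  xget 0 [set N : 'M[R]_n | is_spectral_pinv M N].

Definition simplex (R : realType) n : set 'cV[R]_n :=
  [set u : 'cV[R]_n | (forall i, 0 <= u i 0) /\ \sum_(i < n) u i 0 = 1].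

Definition ewdiv (R : realType) n (u v : 'cV[R]_n) : 'cV[R]_n :=
  \col_(i < n) (u i 0 / v i 0).

Definition ewexp (R : realType) n (u : 'cV[R]_n) : 'cV[R]_n := map_mx expR u.

Definition ewln (R : realType) n (u : 'cV[R]_n) : 'cV[R]_n := map_mx (@ln R) u.

(* The term of a zero entry is 0 * (ln 0 - 1) = 0, as the usual convention
   0 log 0 = 0 requires. *)
Definition Ent (R : realType) n m (P : 'M[R]_(n, m)) : R :=
  - \sum_(i < n) \sum_(j < m) P i j * (ln (P i j) - 1).

Definition transport_polytope (R : realType) n m
    (a : 'cV[R]_n) (b : 'cV[R]_m) : set 'M[R]_(n, m) :=
  [set P : 'M[R]_(n, m) | [/\ forall i j, 0 <= P i j, P *m const_mx 1 = a &
               P^T *m const_mx 1 = b]].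

Definition eot_objective (R : realType) n m (C : 'M[R]_(n, m)) (eps : R)
    (P : 'M[R]_(n, m)) : R :=
  \sum_(i < n) \sum_(j < m) P i j * C i j - eps * Ent P.

Definition eot_argmin (R : realType) n m (C : 'M[R]_(n, m))
    (a : 'cV[R]_n) (b : 'cV[R]_m) (eps : R) : set 'M[R]_(n, m) :=
  [set P : 'M[R]_(n, m) | transport_polytope a b P /\
     forall Q, transport_polytope a b Q ->
       eot_objective C eps P <= eot_objective C eps Q].

Definition eot_plan (R : realType) n m (C : 'M[R]_(n, m))
    (a : 'cV[R]_n) (b : 'cV[R]_m) (eps : R) : 'M[R]_(n, m) :=
  xget 0 (eot_argmin C a b eps).

Definition gibbs_kernel (R : realType) n m (C : 'M[R]_(n, m)) (eps : R) :
    'M[R]_(n, m) :=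
  \matrix_(i < n, j < m) expR (- C i j / eps).

Definition sinkhorn_map (R : realType) n m (C : 'M[R]_(n, m))
    (a : 'cV[R]_n) (b : 'cV[R]_m) (eps : R) (x : 'cV[R]_n) : 'cV[R]_n :=
  let K := gibbs_kernel C eps in
  ewln a - ewln (K *m ewdiv b (K^T *m ewexp x)).

Definition sinkhorn_plan (R : realType) n m (C : 'M[R]_(n, m))
    (b : 'cV[R]_m) (eps : R) (x : 'cV[R]_n) : 'M[R]_(n, m) :=
  let K := gibbs_kernel C eps in
  diag_mx (ewexp x)^T *m K *m diag_mx (ewdiv b (K^T *m ewexp x))^T.

(* Main.v *)
Require Import Defs.
From HB Require Import structures.
From mathcomp Require Import all_boot all_order all_algebra.
From mathcomp Require Import all_classical all_reals all_analysis.
From mathcomp Require Import ring lra complex.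

Set Implicit Arguments.
Unset Strict Implicit.
Unset Printing Implicit Defensive.

Import Order.TTheory GRing.Theory Num.Theory.
Import numFieldNormedType.Exports.

Local Open Scope classical_set_scope.
Local Open Scope ring_scope.

(** Write [c = C / eps].  Everything is expressed through the coupling
    [P(x)_ij = b_j * softmax_i (x - c_(., j))], whose columns always sum to [b],
    and through the map [F(x) = x + ln a - ln (row sums of P(x))].  Both depend
    on [x] only up to additive constants ([P] is invariant, [F] equivariant), so
    the natural size of a vector is its oscillation, the difference between its
    largest and smallest entries.

    _Convergence of the iterates._  The derivative of [F] in [x] is
    [diag(1/r) P diag(1/b) P^T], with [r] the row sums of [P]: a product of two
    stochastic matrices.  When [|c| <= M], any two rows of the first factor share
    the fraction [exp(-4M)] of their mass, whatever [x] is, so the derivative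
    contracts the oscillation by [q = 1 - exp(-4M)] ([osc_two_step]), and so does
    [F] by the mean value theorem ([osc_scaling]).  Since [a] and [r] have the
    same total mass, the increment [F(x) - x] takes both signs and is bounded by
    its own oscillation ([norm_scaling_increment]); hence the iterates converge
    linearly, at a rate that is uniform where [c] is bounded.

    _The limit coupling._  At a fixed point the row sums are [a], so the coupling
    is feasible; its logarithm is a sum of potentials minus [c], so the excess
    cost of any competitor is [eps] times a relative entropy, which is positive
    unless the two agree ([eot_argmin_unique]).  The matrix [A] satisfies detailed
    balance with weights [a], hence is similar to a symmetric matrix and is
    diagonalizable ([detailed_balance_diagonalizable]).

    _Derivatives._  Differentiating the recursion gives
    [J_(k+1) = A_k J_k + B_k], where [A_k] and [B_k] converge linearly to [A] and
    [B].  The vector [J = (I - A)^# B] solves [J = A J + B] up to an element of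
    the kernel of [I - A], that is, up to a constant, because a contraction of
    the oscillation fixes constants only.  Therefore the oscillation of
    [J_k - J] obeys a contracting recursion with a linearly vanishing
    perturbation and vanishes linearly.  As the derivative of the coupling does
    not see constants, [dP_k] converges linearly, locally uniformly, to
    [dP/dx J + dP/dt] ([lin_cvg_dicoupling]).

    _Differentiability of the optimal coupling._  The couplings converge
    pointwise and their derivatives converge locally uniformly, so the limit is
    continuously differentiable and its derivative is the limit of the
    derivatives ([C1_with_limit]). *)

(** * Entrywise differential calculus *)

Section Calculus.
Context {R : realType} {V : normedModType R}.
Implicit Types (f g df dg : V -> R) (x : V).

Lemma is_diff_ext (W : normedModType R) x (f df dg : V -> W) :
  is_diff x f df -> df =1 dg -> is_diff x f dg.
Proof. by move=> Hf /funext <-. Qed.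

Lemma is_diff_add x f g df dg : is_diff x f df -> is_diff x g dg ->
  is_diff x (fun y => f y + g y) (fun v => df v + dg v).
Proof. by move=> Hf Hg; exact: (is_diffD Hf Hg). Qed.

Lemma is_diff_sub x f g df dg : is_diff x f df -> is_diff x g dg ->
  is_diff x (fun y => f y - g y) (fun v => df v - dg v).
Proof. by move=> Hf Hg; exact: (is_diffB Hf Hg). Qed.

Lemma is_diff_mul x f g df dg : is_diff x f df -> is_diff x g dg ->
  is_diff x (fun y => f y * g y) (fun v => f x * dg v + g x * df v).
Proof. by move=> Hf Hg; exact: (is_diffM Hf Hg). Qed.

Lemma is_diff_sum (W : normedModType R) (I : Type) (s : seq I) x
    (f df : I -> V -> W) : (forall i, is_diff x (f i) (df i)) ->
  is_diff x (fun y => \sum_(i <- s) f i y) (fun v => \sum_(i <- s) df i v).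
Proof.
move=> H; elim: s => [|i s IH].
  have E (g : I -> V -> W) : (fun y => \sum_(j <- [::]) g j y) = cst 0.
    by apply/funext => y; rewrite big_nil.
  by rewrite !E; exact: is_diff_cst.
have E (g : I -> V -> W) : (fun y => \sum_(j <- i :: s) g j y) =
    g i + (fun y => \sum_(j <- s) g j y).
  by apply/funext => y; rewrite big_cons.
by rewrite !E; exact: (is_diffD (H i) IH).
Qed.

Lemma is_diff_inv x f df : is_diff x f df -> f x != 0 ->
  is_diff x (fun y => (f y)^-1) (fun v => - (f x) ^- 2 * df v).
Proof.
move=> Hf f0; apply: DiffDef; first by apply: differentiableV => //; case: Hf.
by rewrite diffV // diff_val.
Qed.

Lemma is_diff_comp1 x f df (h : R -> R) h' : is_diff x f df ->
  is_derive (f x) 1 h h' -> is_diff x (fun y => h (f y)) (fun v => h' * df v).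
Proof.
move=> Hf Hh.
have dh : is_diff (f x) h (fun u => u *: h').
  apply: DiffDef; first by apply/derivable1_diffP.
  by rewrite diff1E ?derive1E ?derive_val //; apply/derivable1_diffP.
have -> : (fun v => h' * df v) = (fun u => u *: h') \o df.
  by apply/funext => v /=; rewrite mulrC.
exact: (is_diff_comp Hf dh).
Qed.

Lemma is_diff_exp x f df : is_diff x f df ->
  is_diff x (fun y => expR (f y)) (fun v => expR (f x) * df v).
Proof. by move=> Hf; apply: is_diff_comp1. Qed.

Lemma is_diff_ln x f df : is_diff x f df -> 0 < f x ->
  is_diff x (fun y => ln (f y)) (fun v => (f x)^-1 * df v).
Proof. by move=> Hf f0; apply: is_diff_comp1; exact: is_derive1_ln. Qed.

Lemma cvg_mx_entries (X : Type) (F : set_system X) (FF : Filter F) m n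
    (T : pseudoMetricType R) (f : X -> 'M[T]_(m, n)) (M : 'M[T]_(m, n)) :
  (forall i j, (f x i j) @[x --> F] --> M i j) -> f @ F --> M.
Proof.
move=> H; apply/cvg_ballP => e e0.
have : \forall x \near F, forall i j, ball (M i j) e (f x i j).
  apply: filter_forall => i; apply: filter_forall => j.
  by move/cvg_ballP : (H i j) => /(_ e e0).
by apply: filterS => x h; split.
Qed.

Lemma is_diff_mx x m n (f df : V -> 'M[R]_(m, n)) :
  (forall i j, is_diff x (fun y => f y i j) (fun v => df v i j)) ->
  is_diff x f df.
Proof.
move=> H.
have E (g : V -> 'M[R]_(m, n)) :
    g = fun y => \sum_i \sum_j g y i j *: delta_mx i j.
  by apply/funext => y; rewrite [LHS]matrix_sum_delta.
rewrite (E f) (E df); apply: is_diff_sum => i; apply: is_diff_sum => j.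
apply: DiffDef; first by apply: differentiableZl; case: (H i j).
by rewrite diffZl ?diff_val//; case: (H i j).
Qed.

Lemma is_diff_entry x m n (f df : V -> 'M[R]_(m, n)) i j :
  is_diff x f df -> is_diff x (fun y => f y i j) (fun v => df v i j).
Proof.
move=> Hf.
have @c : {linear 'M[R]_(m, n) -> R}.
  by exists (fun N : 'M[R]_(_, _) => N i j); do 2![eexists]; do ?[constructor];
     rewrite ?mxE// => ? *; rewrite ?mxE//; move=> ?; rewrite !mxE.
have Hc : is_diff (f x) (fun N : 'M[R]_(m, n) => N i j)
    (fun N : 'M[R]_(m, n) => N i j).
  apply: DiffDef; first exact: differentiable_coord.
  exact: (@diff_lin _ _ _ c _ (@coord_continuous _ _ _ i j)).
exact: (is_diff_comp Hf Hc).
Qed.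

(** A function together with its derivative; as in [C1_on], the continuity of
    the derivative is tested one direction at a time. *)
Definition C1_with (W : normedModType R) (O : set V) (f : V -> W)
    (df : V -> V -> W) :=
  (forall x, O x -> is_diff x f (df x)) /\
  (forall v x, O x -> {for x, continuous (fun y => df y v)}).

Lemma C1_onP (W : normedModType R) (O : set V) (f : V -> W) : open O ->
  C1_on O f <-> C1_with O f (fun x v => 'd f x v).
Proof.
move=> oO; split=> -[H1 H2]; split => // x Ox.
  by apply/differentiableP/H1.
by case: (H1 x Ox).
Qed.

Lemma C1_with_on (W : normedModType R) (O : set V) (f : V -> W)
    (df : V -> V -> W) : open O ->
  C1_with O f df -> C1_on O f.
Proof.
move=> oO -[H1 H2]; split => [x Ox|v x Ox]; first by case: (H1 x Ox).
rewrite /prop_for /continuous_at.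
have -> : 'd f x v = df x v by have [_ ->] := H1 x Ox.
apply: cvg_trans (H2 v x Ox).
apply: near_eq_cvg; near=> y.
have Oy : O y by near: y; exact: open_nbhs_nbhs.
by have [_ ->] := H1 y Oy.
Unshelve. all: by end_near. Qed.

Lemma C1_with_mx (O : set V) m n (f : V -> 'M[R]_(m, n))
    (df : V -> V -> 'M[R]_(m, n)) :
  (forall i j, C1_with O (fun x => f x i j) (fun x v => df x v i j)) ->
  C1_with O f df.
Proof.
move=> H; split=> [x Ox|v x Ox].
  by apply: is_diff_mx => i j; have [h _] := H i j; exact: h.
by apply: cvg_mx_entries => i j; have [_ h] := H i j; exact: h.
Qed.

Lemma C1_on_entry (O : set V) m n (f : V -> 'M[R]_(m, n)) i j : open O ->
  C1_on O f -> C1_with O (fun x => f x i j) (fun x v => 'd f x v i j).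
Proof.
move=> oO /(C1_onP _ oO)[H1 H2]; split=> [x Ox|v x Ox].
  exact: is_diff_entry (H1 x Ox).
apply: (@continuous_comp _ _ _ (fun y => 'd f y v)
  (fun M : 'M[R]_(m, n) => M i j)).
  exact: H2.
exact: coord_continuous.
Qed.

Lemma C1_with_continuous (W : normedModType R) (O : set V) (f : V -> W)
    (df : V -> V -> W) x :
  C1_with O f df -> O x -> {for x, continuous f}.
Proof. by move=> [H _] /H [+ _]; exact: differentiable_continuous. Qed.

End Calculus.

(** * Couplings in scaling form *)

Section Softmax.
Context {R : realType}.

Definition softmax n (y : 'I_n -> R) i := expR (y i) / \sum_l expR (y l).

Lemma sum_expR_gt0 n (y : 'I_n -> R) (i : 'I_n) : 0 < \sum_l expR (y l).
Proof.
rewrite (bigD1 i) //= ltr_wpDr ?expR_gt0 //.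
by apply: sumr_ge0 => l _; exact: expR_ge0.
Qed.

Lemma softmax_gt0 n (y : 'I_n -> R) i : 0 < softmax y i.
Proof. by rewrite divr_gt0 ?expR_gt0 // (sum_expR_gt0 _ i). Qed.

Lemma sum_softmax n (y : 'I_n -> R) : (0 < n)%N -> \sum_i softmax y i = 1.
Proof.
move=> n0; rewrite -mulr_suml divff // gt_eqF //.
exact: (sum_expR_gt0 _ (Ordinal n0)).
Qed.

Lemma is_diff_softmax (V : normedModType R) n t (y : V -> 'I_n -> R)
    (dy : V -> 'I_n -> R) i :
  (forall l, is_diff t (fun s => y s l) (fun v => dy v l)) ->
  is_diff t (fun s => softmax (y s) i)
    (fun v => softmax (y t) i * (dy v i - \sum_l softmax (y t) l * dy v l)).
Proof.
move=> H; set S := fun s => \sum_l expR (y s l).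
have S0 : S t != 0 by rewrite gt_eqF // /S (sum_expR_gt0 _ i).
have HS : is_diff t S (fun v => \sum_l expR (y t l) * dy v l).
  by apply: is_diff_sum => l; exact: is_diff_exp.
apply: is_diff_ext (is_diff_mul (is_diff_exp (H i)) (is_diff_inv HS S0)) _ => v.
rewrite /softmax -/(S t).
under [in RHS]eq_bigr do rewrite mulrAC.
rewrite -mulr_suml; field.
exact: S0.
Qed.

Context {n m : nat}.
Implicit Types (x a da dx : 'I_n -> R) (c dc p : 'I_n -> 'I_m -> R)
  (b db : 'I_m -> R).

(** The matrix [diag(e^x) K diag(b / (K^T e^x))] with [K = exp(- c)]: column [j]
    distributes the mass [b j] by a softmax, which keeps every entry explicit
    and makes the column constraint automatic. *)
Definition coupling x c b i j := b j * softmax (fun l => x l - c l j) i.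

Lemma coupling_gt0 x c b i j : 0 < b j -> 0 < coupling x c b i j.
Proof. by move=> b0; rewrite mulr_gt0 ?softmax_gt0. Qed.

Lemma coupling_row_gt0 x c b i : (0 < m)%N -> (forall j, 0 < b j) ->
  0 < \sum_j coupling x c b i j.
Proof.
move=> m0 b0; rewrite (bigD1 (Ordinal m0)) //= ltr_wpDr ?coupling_gt0 //.
by apply: sumr_ge0 => j _; rewrite ltW // coupling_gt0.
Qed.

Lemma coupling_col_sum x c b j : (0 < n)%N -> \sum_i coupling x c b i j = b j.
Proof. by move=> n0; rewrite -mulr_sumr sum_softmax ?mulr1. Qed.

(** The Sinkhorn map [ln a - ln (K (b / (K^T e^x)))], written with the row sums
    of the coupling at [x]. *)
Definition scaling x c a b i := x i + ln (a i) - ln (\sum_j coupling x c b i j).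

(** The differentials of [coupling] and [scaling] depend on the base point only
    through the coupling [p] there; the arguments [dx], [dc], [da] and [db] are
    the differentials of the data. *)
Definition dcoupling p b dx dc db i j :=
  p i j * (dx i - dc i j + db j / b j - \sum_l p l j / b j * (dx l - dc l j)).

Definition dscaling p a b dx dc da db i :=
  da i / a i + (\sum_j p i j)^-1 *
    \sum_j p i j * (dc i j - db j / b j + \sum_l p l j / b j * (dx l - dc l j)).

(** With [x], [c] and [b] functions on an arbitrary normed space, this one chain
    rule gives the derivatives in [x] alone, in the parameter alone, along a
    segment, and of the iterates. *)
Lemma is_diff_coupling (V : normedModType R) t (x dx : V -> 'I_n -> R)
    (c dc : V -> 'I_n -> 'I_m -> R) (b db : V -> 'I_m -> R) i j :
  0 < b t j ->
  (forall l, is_diff t (fun s => x s l) (fun v => dx v l)) ->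
  (forall l j, is_diff t (fun s => c s l j) (fun v => dc v l j)) ->
  (forall j, is_diff t (fun s => b s j) (fun v => db v j)) ->
  is_diff t (fun s => coupling (x s) (c s) (b s) i j)
    (fun v => dcoupling (coupling (x t) (c t) (b t)) (b t)
                (dx v) (dc v) (db v) i j).
Proof.
move=> b0 Hx Hc Hb.
apply: is_diff_ext (is_diff_mul (Hb j)
  (is_diff_softmax i (fun l => is_diff_sub (Hx l) (Hc l j)))) _ => v.
rewrite /dcoupling /coupling.
under [in RHS]eq_bigr do rewrite (mulrAC (b t j)) divff ?gt_eqF // mul1r.
field; by rewrite gt_eqF.
Qed.

Lemma is_diff_scaling (V : normedModType R) t (x dx : V -> 'I_n -> R)
    (c dc : V -> 'I_n -> 'I_m -> R) (a da : V -> 'I_n -> R)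
    (b db : V -> 'I_m -> R) i : (0 < m)%N ->
  (forall j, 0 < b t j) -> 0 < a t i ->
  (forall l, is_diff t (fun s => x s l) (fun v => dx v l)) ->
  (forall l j, is_diff t (fun s => c s l j) (fun v => dc v l j)) ->
  (forall l, is_diff t (fun s => a s l) (fun v => da v l)) ->
  (forall j, is_diff t (fun s => b s j) (fun v => db v j)) ->
  is_diff t (fun s => scaling (x s) (c s) (a s) (b s) i)
    (fun v => dscaling (coupling (x t) (c t) (b t)) (a t) (b t)
                (dx v) (dc v) (da v) (db v) i).
Proof.
move=> m0 b0 a0 Hx Hc Ha Hb.
pose r s := \sum_j coupling (x s) (c s) (b s) i j.
have r0 : 0 < r t by exact: coupling_row_gt0.
have Hr : is_diff t r (fun v => \sum_j dcoupling (coupling (x t) (c t) (b t))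
    (b t) (dx v) (dc v) (db v) i j).
  by apply: is_diff_sum => j; exact: is_diff_coupling.
apply: is_diff_ext (is_diff_sub (is_diff_add (Hx i) (is_diff_ln (Ha i) a0))
  (is_diff_ln Hr r0)) _ => v.
rewrite /dscaling /dcoupling.
set p := coupling _ _ _; have rE : \sum_j p i j = r t by [].
rewrite rE.
have E : dx v i = (r t)^-1 * (\sum_j p i j * dx v i).
  by rewrite -mulr_suml rE mulrA mulVf ?gt_eqF // mul1r.
rewrite {1}E addrAC -mulrBr -sumrB [in RHS]addrC; congr (_ * _ + _); last first.
  by rewrite mulrC.
by apply: eq_bigr => j _; ring.
Qed.

End Softmax.

(** * Continuity of the derivatives *)

Section PointwiseContinuity.
Context {R : realType} {X : topologicalType} (x : X).
Implicit Types f g : X -> R.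

Lemma continuous_at_add f g : {for x, continuous f} -> {for x, continuous g} ->
  {for x, continuous (fun y => f y + g y)}.
Proof. by move=> Hf Hg; apply: cvgD. Qed.

Lemma continuous_at_sub f g : {for x, continuous f} -> {for x, continuous g} ->
  {for x, continuous (fun y => f y - g y)}.
Proof. by move=> Hf Hg; apply: cvgB. Qed.

Lemma continuous_at_mul f g : {for x, continuous f} -> {for x, continuous g} ->
  {for x, continuous (fun y => f y * g y)}.
Proof. by move=> Hf Hg; apply: cvgM. Qed.

Lemma continuous_at_inv f : {for x, continuous f} -> f x != 0 ->
  {for x, continuous (fun y => (f y)^-1)}.
Proof. by move=> Hf f0; apply: cvgV. Qed.

Lemma continuous_at_sum I (s : seq I) (f : I -> X -> R) :
  (forall i, {for x, continuous (f i)}) ->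
  {for x, continuous (fun y => \sum_(i <- s) f i y)}.
Proof.
move=> H; apply: (@cvg_big _ _ +%R) => [|i _]; first exact: add_continuous.
exact: H.
Qed.

End PointwiseContinuity.

Section ScalingC1.
Context {R : realType} {V : normedModType R} {n m : nat} (O : set V).
Context (x : V -> 'I_n -> R) (dx : V -> V -> 'I_n -> R).
Context (c : V -> 'I_n -> 'I_m -> R) (dc : V -> V -> 'I_n -> 'I_m -> R).
Context (a : V -> 'I_n -> R) (da : V -> V -> 'I_n -> R).
Context (b : V -> 'I_m -> R) (db : V -> V -> 'I_m -> R).
Context (Hx : forall l, C1_with O (fun s => x s l) (fun s v => dx s v l)).
Context (Hc : forall l j,
  C1_with O (fun s => c s l j) (fun s v => dc s v l j)).
Context (Ha : forall l, C1_with O (fun s => a s l) (fun s v => da s v l)).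
Context (Hb : forall j, C1_with O (fun s => b s j) (fun s v => db s v j)).
Context (a0 : forall t, O t -> forall i, 0 < a t i).
Context (b0 : forall t, O t -> forall j, 0 < b t j).

Let p t := coupling (x t) (c t) (b t).

Let is_diff_p t i j : O t -> is_diff t (fun s => p s i j)
  (fun v => dcoupling (p t) (b t) (dx t v) (dc t v) (db t v) i j).
Proof.
move=> Ot; apply: is_diff_coupling; first exact: b0.
- by move=> l; have [h _] := Hx l; exact: h.
- by move=> l k; have [h _] := Hc l k; exact: h.
- by move=> k; have [h _] := Hb k; exact: h.
Qed.

Let continuous_p t i j : O t -> {for t, continuous (fun s => p s i j)}.
Proof. by move=> /(is_diff_p i j)[+ _]; exact: differentiable_continuous. Qed.

Let continuous_mean t v j : O t -> {for t, continuous (fun s =>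
  \sum_l p s l j / b s j * (dx s v l - dc s v l j))}.
Proof.
move=> Ot; apply: continuous_at_sum => l; apply: continuous_at_mul.
  apply: continuous_at_mul; first exact: continuous_p.
  apply: continuous_at_inv; first exact: C1_with_continuous (Hb j) Ot.
  by rewrite gt_eqF // b0.
apply: continuous_at_sub; first by have [_ h] := Hx l; exact: h.
by have [_ h] := Hc l j; exact: h.
Qed.

Let continuous_dlogb t v j : O t ->
  {for t, continuous (fun s => db s v j / b s j)}.
Proof.
move=> Ot; apply: continuous_at_mul; first by have [_ h] := Hb j; exact: h.
apply: continuous_at_inv; first exact: C1_with_continuous (Hb j) Ot.
by rewrite gt_eqF // b0.
Qed.

Lemma C1_with_coupling i j : C1_with O
  (fun s => coupling (x s) (c s) (b s) i j)
  (fun s v => dcoupling (coupling (x s) (c s) (b s)) (b s)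
                (dx s v) (dc s v) (db s v) i j).
Proof.
split=> [t Ot|v t Ot]; first exact: is_diff_p.
apply: continuous_at_mul; first exact: continuous_p.
apply: continuous_at_sub; last exact: continuous_mean.
apply: continuous_at_add; last exact: continuous_dlogb.
apply: continuous_at_sub; first by have [_ h] := Hx i; exact: h.
by have [_ h] := Hc i j; exact: h.
Qed.

Lemma C1_with_scaling i : (0 < m)%N -> C1_with O
  (fun s => scaling (x s) (c s) (a s) (b s) i)
  (fun s v => dscaling (coupling (x s) (c s) (b s)) (a s) (b s)
                (dx s v) (dc s v) (da s v) (db s v) i).
Proof.
move=> m0; split=> [t Ot|v t Ot].
  apply: is_diff_scaling; rewrite ?a0 //; first by move=> j; exact: b0.
  - by move=> l; have [h _] := Hx l; exact: h.
  - by move=> l k; have [h _] := Hc l k; exact: h.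
  - by move=> l; have [h _] := Ha l; exact: h.
  - by move=> k; have [h _] := Hb k; exact: h.
apply: continuous_at_add; first apply: continuous_at_mul.
- by have [_ h] := Ha i; exact: h.
- apply: continuous_at_inv; first exact: C1_with_continuous (Ha i) Ot.
  by rewrite gt_eqF // a0.
apply: continuous_at_mul.
  apply: continuous_at_inv.
    by apply: continuous_at_sum => j; exact: continuous_p.
  by rewrite gt_eqF // coupling_row_gt0 //; exact: b0.
apply: continuous_at_sum => j; apply: continuous_at_mul.
  exact: continuous_p.
apply: continuous_at_add; last exact: continuous_mean.
apply: continuous_at_sub; last exact: continuous_dlogb.
by have [_ h] := Hc i j; exact: h.
Qed.

End ScalingC1.

(** * Linear convergence, locally uniformly in a parameter *)

Section LocallyUniformLinearRate.
Context {R : realType} {V : topologicalType} (v0 : V).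
Implicit Types (u w e : nat -> V -> R) (f g : V -> R).

(** Linear convergence near [v0] with a locally bounded limit.  The bound on the
    limit is part of the definition so that the relation is stable under
    products and under the exponential. *)
Definition lin_cvg u f := exists c r M : R,
  [/\ 0 <= c, 0 <= r, r < 1 & \forall v \near v0,
      `|f v| <= M /\ forall k, `|u k v - f v| <= c * r ^+ k].

Definition locally_bounded f :=
  exists M : R, \forall v \near v0, `|f v| <= M.

Lemma rate_le (c c' r r' : R) k : 0 <= c -> c <= c' -> 0 <= r -> r <= r' ->
  c * r ^+ k <= c' * r' ^+ k.
Proof.
move=> c0 cc r0 rr; apply: ler_pM; rewrite ?exprn_ge0 //.
by apply: lerXn2r; rewrite ?nnegrE // (le_trans r0).
Qed.

Lemma lin_cvg2 u f w g : lin_cvg u f -> lin_cvg w g ->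
  exists c r M : R, [/\ 0 <= c, 0 <= r, r < 1, 0 <= M & \forall v \near v0,
    [/\ `|f v| <= M, `|g v| <= M, forall k, `|u k v - f v| <= c * r ^+ k &
        forall k, `|w k v - g v| <= c * r ^+ k]].
Proof.
move=> [c1 [r1 [M1 [c10 r10 r11 H1]]]] [c2 [r2 [M2 [c20 r20 r21 H2]]]].
exists (Num.max c1 c2), (Num.max r1 r2), (Num.max 0 (Num.max M1 M2)).
split; rewrite ?le_max ?c10 ?r10 ?lexx // ?gt_max ?r11 //.
near=> v.
have [f1 u1] : `|f v| <= M1 /\ forall k, `|u k v - f v| <= c1 * r1 ^+ k.
  by near: v.
have [g1 w1] : `|g v| <= M2 /\ forall k, `|w k v - g v| <= c2 * r2 ^+ k.
  by near: v.
split=> [||k|k].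
- by rewrite !le_max f1 orbT.
- by rewrite !le_max g1 !orbT.
- by apply: (le_trans (u1 k)); apply: rate_le; rewrite ?le_max ?lexx.
- by apply: (le_trans (w1 k)); apply: rate_le; rewrite ?le_max ?lexx ?orbT.
Unshelve. all: by end_near. Qed.

Lemma lin_cvg_add u f w g : lin_cvg u f -> lin_cvg w g ->
  lin_cvg (fun k v => u k v + w k v) (fun v => f v + g v).
Proof.
move=> /lin_cvg2 H /H [c [r [M [c0 r0 r1 M0 {}H]]]].
exists (c + c), r, (M + M); split; rewrite ?addr_ge0 //.
apply: filterS H => v [f1 g1 u1 w1]; split=> [|k].
  by apply: le_trans (ler_normD _ _) _; apply: lerD.
rewrite opprD addrACA mulrDl; apply: le_trans (ler_normD _ _) _.
exact: lerD.
Qed.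

Lemma lin_cvg_cvg u f : lin_cvg u f -> u ^~ v0 @ \oo --> f v0.
Proof.
move=> [c [r [M [c0 r0 r1 /nbhs_singleton[_ H]]]]].
apply/cvgrPdist_le => e e0.
have : geometric c r @ \oo --> 0 by apply: cvg_geometric; rewrite ger0_norm.
move=> /cvgr_le /(_ e e0); apply: filterS => k /= h.
by rewrite distrC; apply: le_trans (H k) h.
Qed.

Lemma lin_cvg_fin (I : finType) (u : I -> nat -> V -> R) (f : I -> V -> R) :
  (forall i, lin_cvg (u i) (f i)) ->
  exists c r : R, [/\ 0 < c, 0 < r, r < 1 &
    \forall v \near v0, forall i k, `|u i k v - f i v| <= c * r ^+ k].
Proof.
move=> H; have /choice[cr Hcr] : forall i, exists cr : R * R,
    [/\ 0 <= cr.1, 0 <= cr.2, cr.2 < 1 & \forall v \near v0, forall k,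
     `|u i k v - f i v| <= cr.1 * cr.2 ^+ k].
  move=> i; have [c [r [M [c0 r0 r1 Hi]]]] := H i.
  by exists (c, r); split=> //; apply: filterS Hi => v [].
exists (1 + \sum_i (cr i).1), (\big[Num.max/2^-1]_i (cr i).2).
have sum0 : 0 <= \sum_i (cr i).1 by apply: sumr_ge0 => i _; have [] := Hcr i.
split.
- by rewrite ltr_pwDl.
- by apply: (@lt_le_trans _ _ 2^-1); [rewrite invr_gt0|exact: bigmax_ge_id].
- apply: bigmax_lt => [|i _]; last by have [] := Hcr i.
  by rewrite invf_lt1 // ltr1n.
apply: filter_forall => i; have [c0 r0 r1] := Hcr i.
apply: filterS => v Hv k; apply: le_trans (Hv k) _; apply: rate_le => //.
  rewrite (bigD1 i) //= addrCA lerDl addr_ge0 //; apply: sumr_ge0 => j _.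
  by have [] := Hcr j.
exact: (le_bigmax _ (fun i => (cr i).2)).
Qed.

Lemma lin_cvg_opp u f : lin_cvg u f ->
  lin_cvg (fun k v => - u k v) (fun v => - f v).
Proof.
move=> [c [r [M [c0 r0 r1 H]]]]; exists c, r, M; split=> //.
apply: filterS H => v [f1 u1]; rewrite normrN; split=> // k.
by rewrite -opprD normrN.
Qed.

Lemma lin_cvg_sub u f w g : lin_cvg u f -> lin_cvg w g ->
  lin_cvg (fun k v => u k v - w k v) (fun v => f v - g v).
Proof. by move=> Hu /lin_cvg_opp; exact: lin_cvg_add. Qed.

Lemma lin_cvg_mul u f w g : lin_cvg u f -> lin_cvg w g ->
  lin_cvg (fun k v => u k v * w k v) (fun v => f v * g v).
Proof.
move=> /lin_cvg2 H /H [c [r [M [c0 r0 r1 M0 {}H]]]].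
exists (c * (c + M + M)), r, (M * M).
split; rewrite ?mulr_ge0 ?addr_ge0 //.
apply: filterS H => v [f1 g1 u1 w1]; split=> [|k].
  by rewrite normrM ler_pM.
have -> : u k v * w k v - f v * g v =
  (u k v - f v) * (w k v - g v) + (u k v - f v) * g v + (w k v - g v) * f v.
  by ring.
have rk1 : r ^+ k <= 1 by rewrite exprn_ile1 // ltW.
have rk0 : 0 <= r ^+ k by rewrite exprn_ge0.
have -> : c * (c + M + M) * r ^+ k =
  c * r ^+ k * c + c * r ^+ k * M + c * r ^+ k * M by ring.
apply: le_trans (ler_normD _ _) _; apply: lerD.
  apply: le_trans (ler_normD _ _) _; rewrite !normrM; apply: lerD.
    apply: ler_pM => //; apply: le_trans (w1 k) _.
    by rewrite ler_piMr.
  exact: ler_pM.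
by rewrite normrM; exact: ler_pM.
Qed.

Lemma lin_cvg_const f : locally_bounded f -> lin_cvg (fun _ => f) f.
Proof.
move=> [M H]; exists 0, 0, M; split => //.
apply: filterS H => v fM; split=> // k.
by rewrite subrr normr0 mul0r.
Qed.

Lemma continuous_locally_bounded f : {for v0, continuous f} ->
  locally_bounded f.
Proof.
move=> /cvgr_norm_le H; exists (`|f v0| + 1); apply: H.
by rewrite ltrDl.
Qed.

Lemma lin_cvg_sum (I : Type) (s : seq I) (u : I -> nat -> V -> R)
    (f : I -> V -> R) : (forall i, lin_cvg (u i) (f i)) ->
  lin_cvg (fun k v => \sum_(i <- s) u i k v) (fun v => \sum_(i <- s) f i v).
Proof.
move=> H; elim: s => [|i s IH].
  have E (h : I -> V -> R) : (fun v => \sum_(i <- [::]) h i v) = cst 0.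
    by apply/funext => v; rewrite big_nil.
  have -> : (fun (k : nat) v => \sum_(i <- [::]) u i k v) = (fun=> cst 0).
    by apply/funext => k; rewrite (E (fun i => u i k)).
  rewrite E; apply: lin_cvg_const; exists 0; apply: nearW => v.
  by rewrite normr0.
have E (h : I -> V -> R) : (fun v => \sum_(j <- i :: s) h j v) =
    (fun v => h i v + \sum_(j <- s) h j v).
  by apply/funext => v; rewrite big_cons.
have -> : (fun k v => \sum_(j <- i :: s) u j k v) =
    (fun k v => u i k v + \sum_(j <- s) u j k v).
  by apply/funext => k; rewrite (E (fun i => u i k)).
by rewrite E; exact: lin_cvg_add.
Qed.

Lemma lin_cvg_near u f w g : lin_cvg u f ->
  (\forall v \near v0, f v = g v /\ forall k, u k v = w k v) -> lin_cvg w g.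
Proof.
move=> [c [r [M [c0 r0 r1 H]]]] E; exists c, r, M; split=> //.
by apply: filterS2 E H => v [<- uw] [fM H]; split=> // k; rewrite -uw.
Qed.

Lemma lin_cvg_shift u f : lin_cvg u f -> lin_cvg (fun k => u k.+1) f.
Proof.
move=> [c [r [M [c0 r0 r1 H]]]]; exists c, r, M; split=> //.
apply: filterS H => v [fM H]; split=> // k; apply: le_trans (H k.+1) _.
apply: ler_wpM2l => //; rewrite exprS ler_piMl ?exprn_ge0 //; exact: ltW.
Qed.

(** Convergence bounds only the late terms away from zero, whence the lower
    bound [d] on all of them. *)
Lemma lin_cvg_inv u f d : 0 < d ->
  (\forall v \near v0, d <= f v /\ forall k, d <= u k v) ->
  lin_cvg u f -> lin_cvg (fun k v => (u k v)^-1) (fun v => (f v)^-1).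
Proof.
move=> d0 Hd [c [r [M [c0 r0 r1 H]]]]; exists (c / (d * d)), r, d^-1.
split=> //; first by rewrite divr_ge0 // mulr_ge0 // ltW.
apply: filterS2 Hd H => v [df du] [fM Hu].
have f0 := lt_le_trans d0 df; split=> [|k].
  by rewrite gtr0_norm ?invr_gt0 // lef_pV2.
have u0 := lt_le_trans d0 (du k).
have -> : (u k v)^-1 - (f v)^-1 = - (u k v - f v) / (u k v * f v).
  by field; rewrite !gt_eqF.
rewrite normrM normrN (gtr0_norm (x := _^-1)) ?invr_gt0 ?mulr_gt0 //.
rewrite mulrAC; apply: ler_pM => //; first by rewrite invr_ge0 mulr_ge0 // ltW.
by rewrite lef_pV2 ?posrE ?mulr_gt0 // ler_pM // ltW.
Qed.

Lemma expR_lip (a b M : R) : a <= M -> b <= M ->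
  `|expR a - expR b| <= expR M * `|a - b|.
Proof.
wlog ba : a b / b <= a.
  move=> W aM bM; have [/W|/ltW/W] := leP b a; first exact.
  by rewrite distrC [X in _ -> _ <= _ * X]distrC; apply.
move=> aM _; rewrite !ger0_norm ?subr_ge0 ?ler_expR //.
have -> : expR a - expR b = expR a * (1 - expR (b - a)).
  by rewrite mulrBr mulr1 -expRD subrKC.
apply: ler_pM; rewrite ?expR_ge0 ?ler_expR //.
  by rewrite subr_ge0 expR_le1 subr_le0.
by have := expR_ge1Dx (b - a); lra.
Qed.

Lemma lin_cvg_exp u f : lin_cvg u f ->
  lin_cvg (fun k v => expR (u k v)) (fun v => expR (f v)).
Proof.
move=> [c [r [M [c0 r0 r1 H]]]]; exists (expR (M + c) * c), r, (expR M).
split; rewrite ?mulr_ge0 ?expR_ge0 //.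
apply: filterS H => v [fM uf]; split=> [|k].
  by rewrite ger0_norm ?expR_ge0 // ler_expR (le_trans (ler_norm _)).
have fM' : f v <= M + c by rewrite (le_trans (ler_norm _)) // ler_wpDr.
have uk : u k v <= M + c.
  have -> : u k v = f v + (u k v - f v) by rewrite subrKC.
  apply: lerD; first exact: le_trans (ler_norm _) fM.
  apply: le_trans (ler_norm _) (le_trans (uf k) _).
  by rewrite ler_piMr // exprn_ile1 // ltW.
apply: le_trans (expR_lip uk fM') _; rewrite -mulrA ler_wpM2l ?expR_ge0 //.
Qed.

Lemma lin_cvg_squeeze u f e : locally_bounded f -> lin_cvg e (fun=> 0) ->
  (\forall v \near v0, forall k, `|u k v - f v| <= e k v) -> lin_cvg u f.
Proof.
move=> [M HM] [c [r [M' [c0 r0 r1 H]]]] E; exists c, r, M; split=> //.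
apply: filterS3 HM E H => v fM Ev [_ Hv]; split=> // k.
apply: le_trans (Ev k) (le_trans (ler_norm _) _); rewrite -[e k v]subr0.
exact: Hv.
Qed.

(** For a contraction of factor [q] perturbed by a term of rate [r], any rate
    strictly between [max q r] and 1 works; the rate [max q r] itself fails when
    [q = r], because terms of order [k * q ^+ k] appear. *)
Lemma lin_cvg_recursion e d (q : R) : 0 <= q -> q < 1 ->
  locally_bounded (e 0%N) -> lin_cvg d (fun=> 0) ->
  (\forall v \near v0, forall k,
     0 <= e k v /\ e k.+1 v <= q * e k v + d k v) ->
  lin_cvg e (fun=> 0).
Proof.
move=> q0 q1 [E0 HE] [c [r [M [c0 r0 r1 Hd]]]] He.
pose s := (Num.max q r + 1) / 2.
have qs : q < s.
  have : q <= Num.max q r by rewrite le_max lexx.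
  by rewrite /s; lra.
have rs : r < s.
  have : r <= Num.max q r by rewrite le_max lexx orbT.
  by rewrite /s; lra.
have s1 : s < 1.
  have : Num.max q r < 1 by rewrite gt_max q1.
  by rewrite /s; lra.
have s0 : 0 <= s by apply: le_trans q0 _; exact: ltW.
(* The least constant for which the induction step closes. *)
pose D := Num.max E0 (c / (s - q)).
have cD : c <= (s - q) * D.
  by rewrite mulrC -ler_pdivrMr ?subr_gt0 // /D le_max lexx orbT.
have D0 : 0 <= D by rewrite /D le_max divr_ge0 ?orbT // subr_ge0 ltW.
exists D, s, 0; split=> //.
apply: filterS3 HE Hd He => v Ev [_ dv] ev; split=> [|k].
  by rewrite normr0.
rewrite subr0 ger0_norm; last by case: (ev k).
elim: k => [|k IH].
  rewrite expr0 mulr1 (le_trans (ler_norm _)) // (le_trans Ev) //.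
  by rewrite le_max lexx.
have [_ h] := ev k; apply: le_trans h _.
have dk : d k v <= c * s ^+ k.
  apply: le_trans (ler_norm _) _; rewrite -[d k v]subr0.
  by apply: le_trans (dv k) _; apply: rate_le => //; exact: ltW.
have sk : 0 <= s ^+ k by rewrite exprn_ge0.
apply: le_trans (lerD (ler_wpM2l q0 IH) dk) _.
rewrite mulrA -mulrDl exprS mulrA ler_wpM2r //.
by rewrite [D * s]mulrC -lerBrDl -mulrBl.
Qed.

End LocallyUniformLinearRate.

Section GeometricIncrements.
Context {R : realType}.

Lemma dist_geometric_increments (s : nat -> R) (c r : R) k l :
  0 <= c -> 0 <= r -> r < 1 ->
  (forall k, `|s k.+1 - s k| <= c * r ^+ k) ->
  `|s (k + l)%N - s k| <= c / (1 - r) * r ^+ k.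
Proof.
move=> c0 r0 r1 H; have r1' : 0 < 1 - r by rewrite subr_gt0.
suff : `|s (k + l)%N - s k| <= c / (1 - r) * (r ^+ k - r ^+ (k + l)).
  move=> h; apply: le_trans h _; rewrite ler_wpM2l ?divr_ge0 ?(ltW r1') //.
  by rewrite gerBl exprn_ge0.
elim: l => [|l IH]; first by rewrite addn0 !subrr normr0 mulr0.
rewrite addnS -(subrKA (s (k + l)%N)); apply: le_trans (ler_normD _ _) _.
apply: le_trans (lerD (H _) IH) _; rewrite exprS.
by rewrite le_eqVlt; apply/orP; left; apply/eqP; field; rewrite gt_eqF.
Qed.

Lemma cvg_geometric_increments (s : nat -> R) (c r : R) :
  0 <= c -> 0 <= r -> r < 1 ->
  (forall k, `|s k.+1 - s k| <= c * r ^+ k) -> cvgn s.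
Proof.
move=> c0 r0 r1 H.
have : cvgn (series (telescope s)).
  apply: normed_cvg; apply: (@series_le_cvg _ _ (geometric c r)).
  - by move=> k; rewrite normr_ge0.
  - by move=> k; rewrite /= mulr_ge0 // exprn_ge0.
  - by move=> k; exact: H.
  by apply: is_cvg_geometric_series; rewrite ger0_norm.
move=> /cvg_ex[l sl]; apply/cvg_ex; exists (s 0%N + l).
have E : s = (fun k => s 0%N + series (telescope s) k).
  by apply/funext => k; rewrite telescopeK /= subrKC.
rewrite {1}E.
by apply: cvgD => //; exact: cvg_cst.
Qed.

Lemma lim_geometric_increments (s : nat -> R) (c r l : R) k :
  0 <= c -> 0 <= r -> r < 1 ->
  (forall k, `|s k.+1 - s k| <= c * r ^+ k) -> s @ \oo --> l ->
  `|s k - l| <= c / (1 - r) * r ^+ k.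
Proof.
move=> c0 r0 r1 H sl; rewrite distrC.
have h : (fun i => `|s i - s k|) @ \oo --> `|l - s k|.
  by apply: cvg_norm; apply: cvgB => //; exact: cvg_cst.
rewrite -(cvg_lim _ h) //; apply: limr_le.
  by apply/cvg_ex; exists `|l - s k|.
near=> i; have ki : (k <= i)%N by near: i; exact: nbhs_infty_ge.
by rewrite -(subnKC ki); exact: dist_geometric_increments.
Unshelve. all: by end_near. Qed.

Lemma lin_cvg_of_increments (V : topologicalType) (v0 : V) (u : nat -> V -> R)
    (f : V -> R) : locally_bounded v0 (u 0%N) ->
  lin_cvg v0 (fun k v => u k.+1 v - u k v) (fun=> 0) ->
  (\forall v \near v0, u ^~ v @ \oo --> f v) -> lin_cvg v0 u f.
Proof.
move=> [M0 H0] [c [r [M [c0 r0 r1 Hd]]]] Hf.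
exists (c / (1 - r)), r, (M0 + c / (1 - r)); split=> //.
  by rewrite divr_ge0 // subr_ge0 ltW.
apply: filterS3 H0 Hd Hf => v u0v [_ dv] fv.
have H k : `|u k v - f v| <= c / (1 - r) * r ^+ k.
  apply: (@lim_geometric_increments (fun k => u k v)) => // i.
  by rewrite -[X in `|X|]subr0.
split=> //; have -> : f v = u 0%N v - (u 0%N v - f v) by rewrite subKr.
apply: le_trans (ler_normB _ _) _; apply: lerD => //.
by have := H 0%N; rewrite expr0 mulr1.
Qed.

End GeometricIncrements.

(** * Contraction of the oscillation *)

Section Oscillation.
Context {R : realType}.

Definition osc n (y : 'I_n -> R) : R :=
  \big[Num.max/0]_(ij : 'I_n * 'I_n) (y ij.1 - y ij.2).

Lemma osc_ge0 n (y : 'I_n -> R) : 0 <= osc y.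
Proof. exact: bigmax_ge_id. Qed.

Lemma le_osc n (y : 'I_n -> R) i j : y i - y j <= osc y.
Proof.
exact: (le_bigmax _ (fun ij : 'I_n * 'I_n => y ij.1 - y ij.2) (i, j)).
Qed.

Lemma osc_le n (y : 'I_n -> R) D : 0 <= D ->
  (forall i j, y i - y j <= D) -> osc y <= D.
Proof. by move=> D0 H; apply: bigmax_le => // -[i j] _ /=. Qed.

Lemma osc_le_norm n (y : 'I_n -> R) D : 0 <= D ->
  (forall i, `|y i| <= D) -> osc y <= D + D.
Proof.
move=> D0 H; apply: osc_le => [|i j]; first exact: addr_ge0.
by apply: le_trans (ler_norm _) (le_trans (ler_normB _ _) _); rewrite lerD.
Qed.

Lemma osc_add n (y z : 'I_n -> R) : osc (fun i => y i + z i) <= osc y + osc z.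
Proof.
apply: osc_le => [|i j]; first by rewrite addr_ge0 ?osc_ge0.
by rewrite opprD addrACA lerD ?le_osc.
Qed.

Lemma exists_le_sum n (f g : 'I_n -> R) : (0 < n)%N ->
  \sum_i f i <= \sum_i g i -> exists i, f i <= g i.
Proof.
move=> n0 fg; apply: contrapT => /forallNP H.
suff : \sum_i g i < \sum_i f i by rewrite ltNge fg.
apply: ltr_sum => [|i _].
  by apply/hasP; exists (Ordinal n0); rewrite ?mem_index_enum.
by rewrite ltNge; apply/negP/H.
Qed.

(** Two distributions of the same mass [s] give averages of [y] that differ by at
    most [s * osc y]: both averages may be taken after subtracting the minimum
    of [y], and the second one is then nonnegative. *)
Lemma mass_diff_le_osc m (u w y : 'I_m -> R) (s : R) :
  (forall j, 0 <= u j) -> (forall j, 0 <= w j) ->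
  \sum_j u j = s -> \sum_j w j = s ->
  \sum_j u j * y j - \sum_j w j * y j <= s * osc y.
Proof.
move=> u0 w0 us ws.
have s0 : 0 <= s by rewrite -us; exact: sumr_ge0.
case: m => [|m] in u w y u0 w0 us ws *.
  by rewrite !big_ord0 subrr mulr_ge0 ?osc_ge0.
have [j0 lo] : exists j0, forall j, y j0 <= y j.
  case: (@arg_minP _ _ _ ord0 predT y isT) => j0 _ H.
  by exists j0 => j; exact: H.
have -> : \sum_j u j * y j - \sum_j w j * y j =
    \sum_j u j * (y j - y j0) - \sum_j w j * (y j - y j0).
  have E (v : 'I_m.+1 -> R) :
      \sum_j v j * (y j - y j0) = \sum_j v j * y j - (\sum_j v j) * y j0.
    by rewrite mulr_suml -sumrB; apply: eq_bigr => j _; rewrite mulrBr.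
  by rewrite !E us ws; ring.
rewrite lerBlDr ler_wpDr //.
  by apply: sumr_ge0 => j _; rewrite mulr_ge0 // subr_ge0.
rewrite -us mulr_suml; apply: ler_sum => j _; apply: ler_wpM2l => //.
exact: le_osc.
Qed.

End Oscillation.

Section Contraction.
Context {R : realType} {n m : nat}.
Implicit Types (x y z a : 'I_n -> R) (c p : 'I_n -> 'I_m -> R) (b : 'I_m -> R)
  (M : R).

(** The derivative of the scaling map with respect to its first argument at a
    coupling [p]: the product of two stochastic matrices, obtained from [p] by
    normalising its rows and its columns. *)
Definition two_step p b z i :=
  (\sum_j p i j)^-1 * \sum_j p i j * \sum_l p l j / b j * z l.

Lemma dscaling_two_step p a b dx dc da db i :
  dscaling p a b dx dc da db i =
  two_step p b dx i + dscaling p a b (fun=> 0) dc da db i.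
Proof.
rewrite /dscaling /two_step addrCA -mulrDr -big_split /=; congr (_ + _ * _).
apply: eq_bigr => j _; rewrite -mulrDr; congr (_ * _).
rewrite addrCA; congr (_ + _).
by rewrite -big_split /=; apply: eq_bigr => l _; ring.
Qed.

Lemma dscaling0 p a b i :
  dscaling p a b (fun=> 0) (fun _ _ => 0) (fun=> 0) (fun=> 0) i = 0.
Proof.
rewrite /dscaling mul0r add0r [X in _ * X]big1 ?mulr0 // => j _.
rewrite mul0r subrr add0r big1 ?mulr0 // => l _.
by rewrite mulr0.
Qed.

Section Dobrushin.
Context (p : 'I_n -> 'I_m -> R) (b : 'I_m -> R) (eta : R).
Context (n0 : (0 < n)%N).
Context (m0 : (0 < m)%N).
Context (p0 : forall i j, 0 < p i j).
Context (pb : forall j, \sum_i p i j = b j).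
Context (cross : forall i i' j j',
  eta * (p i' j * p i j') <= p i j * p i' j').

Let r i := \sum_j p i j.

Let r0 i : 0 < r i.
Proof.
rewrite /r (bigD1 (Ordinal m0)) //= ltr_wpDr //.
by apply: sumr_ge0 => j _; exact: ltW.
Qed.

(** Dobrushin's argument: two rows of the row-normalised matrix share at least
    the fraction [eta] of their mass, and the common part cancels. *)
Lemma osc_two_step z : osc (two_step p b z) <= (1 - eta) * osc z.
Proof.
have i0 : 'I_n := Ordinal n0; have j0 : 'I_m := Ordinal m0.
have b0 i j : p i j <= b j.
  rewrite -pb (bigD1 i) //= lerDl; apply: sumr_ge0 => l _; exact: ltW.
pose y j := \sum_l p l j / b j * z l.
have yz : osc y <= osc z.
  apply: osc_le => [|j j']; first exact: osc_ge0.
  have bp k : 0 < b k by exact: lt_le_trans (p0 i0 k) (b0 i0 k).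
  rewrite -[leRHS]mul1r; apply: mass_diff_le_osc.
  - by move=> l; rewrite divr_ge0 // ltW.
  - by move=> l; rewrite divr_ge0 // ltW.
  - by rewrite -mulr_suml pb divff // gt_eqF.
  - by rewrite -mulr_suml pb divff // gt_eqF.
have etaW i i' j : eta * (p i' j / r i') <= p i j / r i.
  rewrite mulrA ler_pdivrMr // mulrAC ler_pdivlMr //.
  rewrite /r !mulr_sumr; apply: ler_sum => j' _.
  by rewrite -mulrA; exact: cross.
have W1 i : \sum_j p i j / r i = 1.
  by rewrite -mulr_suml -/(r i) divff // gt_eqF.
have W0 i j : 0 <= p i j / r i by rewrite divr_ge0 // ltW.
have TE i : two_step p b z i = \sum_j p i j / r i * y j.
  rewrite /two_step mulr_sumr; apply: eq_bigr => j _.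
  by rewrite mulrA [_^-1 * _]mulrC.
have eta1 : eta <= 1.
  have := cross i0 i0 j0 j0.
  by rewrite -[leRHS]mul1r ler_pM2r // mulr_gt0.
apply: osc_le => [|i i']; first by rewrite mulr_ge0 ?osc_ge0 // subr_ge0.
have -> : two_step p b z i - two_step p b z i' =
    \sum_j (p i j / r i - eta * (p i' j / r i')) * y j -
    \sum_j (p i' j / r i' - eta * (p i' j / r i')) * y j.
  by rewrite !TE -!sumrB; apply: eq_bigr => j _; ring.
apply: le_trans (mass_diff_le_osc (s := 1 - eta) _ _ _ _ _) _.
- by move=> j; rewrite subr_ge0.
- by move=> j; rewrite subr_ge0 ler_piMl.
- by rewrite sumrB -mulr_sumr !W1 mulr1.
- by rewrite sumrB -mulr_sumr !W1 mulr1.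
by rewrite ler_wpM2l ?subr_ge0.
Qed.

(** A strict contraction of the oscillation fixes only vectors of oscillation
    zero. *)
Lemma two_step_fixed z : 0 < eta -> two_step p b z =1 z ->
  forall i j, z i = z j.
Proof.
move=> eta_gt0 /funext E i j; have := osc_two_step z; rewrite E => h.
have h0 : osc z <= 0.
  by have := osc_ge0 z; nra.
have := le_osc z i j; have := le_osc z j i; lra.
Qed.

End Dobrushin.

(** Cross-ratios of a coupling do not depend on the potentials [x] and [b], only
    on four entries of [c], each of size at most [M]; this is the finiteness of
    Birkhoff's projective diameter. *)
Lemma coupling_cross x c b M i i' j j' : (forall j, 0 < b j) ->
  (forall i j, `|c i j| <= M) ->
  expR (- (4 * M)) * (coupling x c b i' j * coupling x c b i j') <=
  coupling x c b i j * coupling x c b i' j'.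
Proof.
move=> b0 cM; rewrite /coupling /softmax.
set S := \sum_l _; set S' := \sum_l _.
have S0 : 0 < S by exact: (sum_expR_gt0 _ i).
have S'0 : 0 < S' by exact: (sum_expR_gt0 _ i).
have K k k' :
    b j * (expR (x k - c k j) / S) * (b j' * (expR (x k' - c k' j') / S')) =
    b j * b j' / S / S' * expR (x k + x k' - c k j - c k' j').
  have -> : x k + x k' - c k j - c k' j' = (x k - c k j) + (x k' - c k' j').
    by ring.
  by rewrite [X in _ = _ * X]expRD; field; rewrite !gt_eqF.
rewrite !K mulrCA -expRD ler_wpM2l //.
  by rewrite !divr_ge0 ?mulr_ge0 ?(ltW (b0 _)) ?(ltW S0) ?(ltW S'0).
rewrite ler_expR.
have := cM i j; have := cM i' j; have := cM i j'; have := cM i' j'.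
by rewrite !ler_norml => /andP[? ?] /andP[? ?] /andP[? ?] /andP[? ?]; lra.
Qed.

Lemma osc_two_step_coupling x c b M z : (0 < n)%N -> (0 < m)%N ->
  (forall j, 0 < b j) -> (forall i j, `|c i j| <= M) ->
  osc (two_step (coupling x c b) b z) <= (1 - expR (- (4 * M))) * osc z.
Proof.
move=> n0 m0 b0 cM; apply: osc_two_step => //.
- by move=> i j; exact: coupling_gt0.
- by move=> j; exact: coupling_col_sum.
- by move=> i i' j j'; exact: coupling_cross.
Qed.

Lemma two_step_coupling_fixed x c b z : (0 < n)%N -> (0 < m)%N ->
  (forall j, 0 < b j) -> two_step (coupling x c b) b z =1 z ->
  forall i j, z i = z j.
Proof.
move=> n0 m0 b0; pose M := \sum_i \sum_j `|c i j|.
have cM i j : `|c i j| <= M.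
  rewrite /M (bigD1 i) //= (bigD1 j) //= -addrA lerDl addr_ge0 //.
    exact: sumr_ge0.
  by apply: sumr_ge0 => k _; exact: sumr_ge0.
apply: (@two_step_fixed _ _ (expR (- (4 * M)))) => //.
- by move=> i j; exact: coupling_gt0.
- by move=> j; exact: coupling_col_sum.
- by move=> i i' j j'; exact: coupling_cross.
- exact: expR_gt0.
Qed.

Lemma is_derive_is_diff (f df : R -> R) t : is_diff t f df ->
  is_derive t 1 f (df 1).
Proof.
move=> Hf; apply: DeriveDef; first exact: diff_derivable.
by rewrite deriveE // diff_val.
Qed.

(** The contraction factor does not depend on the base point, so it passes from
    the derivative to the map along the segment from [y] to [x]. *)
Lemma osc_scaling x y c a b M : (0 < n)%N -> (0 < m)%N ->
  (forall i, 0 < a i) -> (forall j, 0 < b j) -> (forall i j, `|c i j| <= M) ->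
  osc (fun i => scaling x c a b i - scaling y c a b i) <=
  (1 - expR (- (4 * M))) * osc (fun i => x i - y i).
Proof.
move=> n0 m0 a0 b0 cM.
pose w (s : R) l := y l + s * (x l - y l).
have D (s : R) i : is_derive s 1 (fun s : R => scaling (w s) c a b i)
    (two_step (coupling (w s) c b) b (fun l => x l - y l) i).
  have cst0 (k : R) : is_diff s (fun=> k) (fun=> 0) by exact: is_diff_cst.
  have wd l : is_diff s (fun s => w s l) (fun v => v * (x l - y l)).
    apply: is_diff_ext (is_diff_add (cst0 (y l))
      (is_diff_mul (is_diff_id s) (cst0 (x l - y l)))) _ => v /=.
    by ring.
  have := is_derive_is_diff (@is_diff_scaling R n m R s w
    (fun v l => v * (x l - y l)) (fun=> c) (fun _ _ _ => 0) (fun=> a)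
    (fun _ _ => 0) (fun=> b) (fun _ _ => 0) i m0 b0 (a0 i) wd
    (fun _ _ => cst0 _) (fun=> cst0 _) (fun=> cst0 _)).
  rewrite dscaling_two_step.
  rewrite dscaling0 addr0.
  by under [X in two_step _ _ X]funext do rewrite mul1r.
have k0 : 0 <= (1 - expR (- (4 * M))) * osc (fun i => x i - y i).
  exact: le_trans (osc_ge0 _) (osc_two_step_coupling x _ n0 m0 b0 cM).
apply: osc_le => // i i'.
pose h (s : R) := scaling (w s) c a b i - scaling (w s) c a b i'.
have hD (s : R) : is_derive s 1 h
    (two_step (coupling (w s) c b) b (fun l => x l - y l) i -
     two_step (coupling (w s) c b) b (fun l => x l - y l) i').
  exact: is_deriveB.
have hc : {within `[0, 1], continuous h}.
  apply: derivable_within_continuous => s _; exact: ex_derive.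
have [s _] := MVT (@ltr01 R) (fun s _ => hD s) hc.
have w1 : w 1 = x by apply/funext => l; rewrite /w mul1r subrKC.
have w0 : w 0 = y by apply/funext => l; rewrite /w mul0r addr0.
rewrite /h w1 w0 subr0 mulr1 => E.
have -> : scaling x c a b i - scaling y c a b i -
   (scaling x c a b i' - scaling y c a b i') =
   scaling x c a b i - scaling x c a b i' -
   (scaling y c a b i - scaling y c a b i') by ring.
rewrite E; apply: le_trans (le_osc _ i i') _.
exact: osc_two_step_coupling.
Qed.

(** Mass balance: the row sums of a coupling and the target [a] have the same
    total, so the increment [ln (a i / r i)] takes both signs, and its sup norm
    is controlled by its oscillation. *)
Lemma norm_scaling_increment x c a b i : (0 < n)%N -> (0 < m)%N ->
  (forall i, 0 < a i) -> (forall j, 0 < b j) ->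
  \sum_i a i = \sum_j b j ->
  `|scaling x c a b i - x i| <= osc (fun i => scaling x c a b i - x i).
Proof.
move=> n0 m0 a0 b0 ab.
pose r i := \sum_j coupling x c b i j.
have r0 k : 0 < r k by exact: coupling_row_gt0.
have ar : \sum_i a i = \sum_i r i.
  rewrite ab /r exchange_big; apply: eq_bigr => j _.
  by rewrite coupling_col_sum.
have E k : scaling x c a b k - x k = ln (a k) - ln (r k).
  by rewrite /scaling -/(r k); ring.
have [i1 h1] : exists i1, a i1 <= r i1 by apply: exists_le_sum; rewrite // ar.
have [i2 h2] : exists i2, r i2 <= a i2 by apply: exists_le_sum; rewrite // ar.
have z1 : scaling x c a b i1 - x i1 <= 0.
  by rewrite E subr_le0 ler_ln ?posrE.
have z2 : 0 <= scaling x c a b i2 - x i2.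
  by rewrite E subr_ge0 ler_ln ?posrE.
have := le_osc (fun i => scaling x c a b i - x i) i i1.
have := le_osc (fun i => scaling x c a b i - x i) i2 i.
by rewrite ler_norml /=; lra.
Qed.

End Contraction.

(** * The Sinkhorn iterates and their limit *)

Section FiniteFamilies.
Context {R : realType} {V : topologicalType} (v0 : V).

Lemma locally_bounded_fin (I : finType) (f : I -> V -> R) :
  (forall i, locally_bounded v0 (f i)) ->
  exists2 M : R, 0 <= M & \forall v \near v0, forall i, `|f i v| <= M.
Proof.
move=> /choice[M H]; exists (\sum_i `|M i|); first exact: sumr_ge0.
apply: filter_forall => i; apply: filterS (H i) => v h.
apply: le_trans h (le_trans (ler_norm _) _).
by rewrite (bigD1 i) //= lerDl; exact: sumr_ge0.
Qed.

Lemma lin_cvg_locally_bounded (u : nat -> V -> R) f :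
  lin_cvg v0 u f -> locally_bounded v0 f.
Proof.
move=> [c [r [M [_ _ _ H]]]]; exists M.
by apply: filterS H => v [].
Qed.

Lemma lin_cvg_norm0 (u : nat -> V -> R) : lin_cvg v0 u (fun=> 0) ->
  lin_cvg v0 (fun k v => `|u k v|) (fun=> 0).
Proof.
move=> [c [r [M [c0 r0 r1 H]]]]; exists c, r, M; split=> //.
apply: filterS H => v [M0 H]; split=> // k.
by rewrite subr0 normr_id -[u k v]subr0.
Qed.

Lemma lin_cvg_osc0 n (y : nat -> V -> 'I_n -> R) :
  (forall i, lin_cvg v0 (fun k v => y k v i) (fun=> 0)) ->
  lin_cvg v0 (fun k v => osc (y k v)) (fun=> 0).
Proof.
move=> H; pose e k v : R := \sum_i (`|y k v i| + `|y k v i|).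
have He : lin_cvg v0 e (fun=> 0).
  have := lin_cvg_sum (index_enum 'I_n)
    (fun i => lin_cvg_add (lin_cvg_norm0 (H i)) (lin_cvg_norm0 (H i))).
  move=> /lin_cvg_near; apply; apply: nearW => v; split=> //.
  by rewrite big1 // => i _; rewrite addr0.
apply: (lin_cvg_squeeze _ He).
  by exists 0; apply: nearW => v; rewrite normr0.
apply: nearW => v k; rewrite subr0 ger0_norm ?osc_ge0 //.
have yi i : `|y k v i| <= \sum_i `|y k v i|.
  by rewrite (bigD1 i) //= lerDl; exact: sumr_ge0.
rewrite /e big_split /=; apply: osc_le_norm => //; exact: sumr_ge0.
Qed.

End FiniteFamilies.

Lemma le0_geometric (R : realType) (y c r : R) : 0 <= r -> r < 1 ->
  (forall k, y <= c * r ^+ k) -> y <= 0.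
Proof.
move=> r0 r1 H.
have h : geometric c r @ \oo --> 0 by apply: cvg_geometric; rewrite ger0_norm.
rewrite -(cvg_lim _ h) //; apply: limr_ge; first by apply/cvg_ex; exists 0.
by apply: nearW => k /=; exact: H.
Qed.

Section Shifts.
Context {R : realType} {n m : nat}.
Implicit Types (x z a dx : 'I_n -> R) (c p dc : 'I_n -> 'I_m -> R).
Implicit Types (b db : 'I_m -> R).

Lemma two_step_shift p b z k i : (forall j, 0 < b j) ->
  (forall j, \sum_i p i j = b j) -> 0 < \sum_j p i j ->
  two_step p b (fun l => z l + k) i = two_step p b z i + k.
Proof.
move=> b0 pb r0; rewrite /two_step /=.
have E j : \sum_l p l j / b j * (z l + k) = \sum_l p l j / b j * z l + k.
  under eq_bigr do rewrite mulrDr; rewrite big_split /= -mulr_suml -mulr_suml.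
  by rewrite pb divff ?mul1r // gt_eqF.
under [X in _ * X = _]eq_bigr do rewrite E mulrDr.
by rewrite big_split /= mulrDr -mulr_suml mulKf // gt_eqF.
Qed.

Lemma dcoupling_shift p b dx dc db k i j : (forall j, 0 < b j) ->
  (forall j, \sum_i p i j = b j) ->
  dcoupling p b (fun l => dx l + k) dc db i j = dcoupling p b dx dc db i j.
Proof.
move=> b0 pb; rewrite /dcoupling /=.
have -> : \sum_l p l j / b j * (dx l + k - dc l j) =
    \sum_l p l j / b j * (dx l - dc l j) + k.
  under eq_bigr do rewrite addrAC mulrDr.
  by rewrite big_split /= -mulr_suml -mulr_suml pb divff ?mul1r // gt_eqF.
by ring.
Qed.

(** In this form every denominator is at least 1 (its term [l = i] equals 1),
    which provides the lower bound that [lin_cvg_inv] asks for. *)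
Lemma coupling_ratio x c b i j : coupling x c b i j =
  b j / \sum_l expR (x l - c l j - (x i - c i j)).
Proof.
rewrite /coupling /softmax; congr (_ * _).
have E l : expR (x l - c l j - (x i - c i j)) =
    expR (x l - c l j) / expR (x i - c i j).
  exact: expRB.
under [in RHS]eq_bigr do rewrite E.
by rewrite -mulr_suml invfM invrK mulrC.
Qed.

(** Along the iteration the inverse row sums are thus exponentials of increments,
    whose convergence is known. *)
Lemma coupling_rowV x c a b i : (0 < m)%N -> 0 < a i -> (forall j, 0 < b j) ->
  (\sum_j coupling x c b i j)^-1 = expR (scaling x c a b i - x i) / a i.
Proof.
move=> m0 a0 b0; have r0 := coupling_row_gt0 x c i m0 b0.
have -> : scaling x c a b i - x i =
    ln (a i) - ln (\sum_j coupling x c b i j) by rewrite /scaling; ring.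
by rewrite expRB !lnK ?posrE // mulrAC divff ?mul1r // gt_eqF.
Qed.

End Shifts.

Section Iteration.
Context {R : realType} {V : normedModType R} {n m : nat} (O : set V).
Context (n0 : (0 < n)%N) (m0 : (0 < m)%N) (oO : open O).
Context (c : V -> 'I_n -> 'I_m -> R) (dc : V -> V -> 'I_n -> 'I_m -> R).
Context (a : V -> 'I_n -> R) (da : V -> V -> 'I_n -> R).
Context (b : V -> 'I_m -> R) (db : V -> V -> 'I_m -> R).
Context (x0 : V -> 'I_n -> R) (dx0 : V -> V -> 'I_n -> R).
Context (Hc : forall l j, C1_with O (fun s => c s l j) (fun s v => dc s v l j)).
Context (Ha : forall l, C1_with O (fun s => a s l) (fun s v => da s v l)).
Context (Hb : forall j, C1_with O (fun s => b s j) (fun s v => db s v j)).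
Context (Hx0 : forall l, C1_with O (fun s => x0 s l) (fun s v => dx0 s v l)).
Context (a0 : forall t, O t -> forall i, 0 < a t i).
Context (b0 : forall t, O t -> forall j, 0 < b t j).
Context (ab : forall t, O t -> \sum_i a t i = \sum_j b t j).

Definition iterate k (t : V) :=
  iter k (fun x => scaling x (c t) (a t) (b t)) (x0 t).

Definition icoupling k t := coupling (iterate k t) (c t) (b t).

Fixpoint diterate k (t v : V) : 'I_n -> R :=
  if k is k'.+1 then
    dscaling (icoupling k' t) (a t) (b t)
      (diterate k' t v) (dc t v) (da t v) (db t v)
  else dx0 t v.

Definition ilimit t i := limn (fun k => iterate k t i).

Definition lcoupling t := coupling (ilimit t) (c t) (b t).

Lemma C1_with_iterate k i :
  C1_with O (fun t => iterate k t i) (fun t v => diterate k t v i).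
Proof.
elim: k i => [|k IH] i; first exact: Hx0.
exact: (C1_with_scaling IH).
Qed.

Lemma C1_with_icoupling k i j : C1_with O (fun t => icoupling k t i j)
  (fun t v => dcoupling (icoupling k t) (b t) (diterate k t v)
                (dc t v) (db t v) i j).
Proof. exact: (C1_with_coupling (C1_with_iterate k)). Qed.

Section AtPoint.
Context (t0 : V) (Ot0 : O t0).

Let nearO : \forall t \near t0, O t.
Proof. exact: open_nbhs_nbhs. Qed.

Let lb_C1 (f : V -> R) df : C1_with O f df -> locally_bounded t0 f.
Proof.
move=> Hf; apply: continuous_locally_bounded.
exact: C1_with_continuous Hf Ot0.
Qed.

Lemma near_contraction_factor : exists M : R, let q := 1 - expR (- (4 * M)) in
  [/\ 0 <= q, q < 1 &
    \forall t \near t0, O t /\ forall i j, `|c t i j| <= M].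
Proof.
have [M M0 HM] := @locally_bounded_fin R V t0 ('I_n * 'I_m)%type
  (fun ij t => c t ij.1 ij.2) (fun ij => lb_C1 (Hc ij.1 ij.2)).
exists M; split.
- by rewrite subr_ge0 expR_le1 oppr_le0 mulr_ge0.
- by rewrite gtrBl expR_gt0.
by apply: filterS2 nearO HM => t Ot H; split=> // i j; exact: (H (i, j)).
Qed.

Lemma lin_cvg_increment i :
  lin_cvg t0 (fun k t => iterate k.+1 t i - iterate k t i) (fun=> 0).
Proof.
have [M [q0 q1 HM]] := near_contraction_factor.
pose e k t : R := osc (fun i => iterate k.+1 t i - iterate k t i).
suff He : lin_cvg t0 e (fun=> 0).
  apply: (lin_cvg_squeeze _ He).
    by exists 0; apply: nearW => v; rewrite normr0.
  apply: filterS nearO => t Ot k; rewrite subr0.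
  by apply: norm_scaling_increment => //; [exact: a0|exact: b0|exact: ab].
apply: (lin_cvg_recursion (d := fun _ _ => 0) q0 q1).
- have lb i' : locally_bounded t0 (fun t => iterate 1 t i' - iterate 0 t i').
    apply: continuous_locally_bounded; apply: continuous_at_sub.
      exact: C1_with_continuous (C1_with_iterate 1 i') Ot0.
    exact: C1_with_continuous (C1_with_iterate 0 i') Ot0.
  have [D D0 HD] := locally_bounded_fin lb.
  exists (D + D); apply: filterS HD => t HD.
  by rewrite ger0_norm ?osc_ge0 //; exact: osc_le_norm.
- by apply: lin_cvg_const; exists 0; apply: nearW => v; rewrite normr0.
apply: filterS HM => t [Ot cM] k; rewrite addr0; split; first exact: osc_ge0.
by apply: osc_scaling => //; [exact: a0|exact: b0].
Qed.

Lemma cvg_iterate i : (fun k => iterate k t0 i) @ \oo --> ilimit t0 i.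
Proof.
have [C [r [_ [C0 r0 r1 /nbhs_singleton[_ H]]]]] := lin_cvg_increment i.
apply: (cvg_geometric_increments C0 r0 r1) => k.
by rewrite -[X in `|X|]subr0; exact: H.
Qed.

End AtPoint.

Lemma lin_cvg_iterate t0 i : O t0 ->
  lin_cvg t0 (fun k t => iterate k t i) (fun t => ilimit t i).
Proof.
move=> Ot0; apply: lin_cvg_of_increments.
- apply: continuous_locally_bounded.
  exact: C1_with_continuous (C1_with_iterate 0 i) Ot0.
- exact: lin_cvg_increment.
have : \forall t \near t0, O t by exact: open_nbhs_nbhs.
by apply: filterS => t Ot; exact: cvg_iterate.
Qed.

(** The contraction bounds the oscillation of [F x - x] at the limit by that at
    the iterates, which tends to zero; by mass balance, oscillation zero forces
    [F x = x] exactly, with no residual constant. *)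
Lemma scaling_ilimit t : O t ->
  scaling (ilimit t) (c t) (a t) (b t) =1 ilimit t.
Proof.
move=> Ot.
pose y i := scaling (ilimit t) (c t) (a t) (b t) i - ilimit t i.
suff y0 : osc y <= 0.
  move=> i; apply/eqP; rewrite -subr_eq0 -normr_le0.
  apply: le_trans _ y0; apply: norm_scaling_increment => //.
  - exact: a0.
  - exact: b0.
  - exact: ab.
have [M [q0 q1 /nbhs_singleton[_ cM]]] := near_contraction_factor Ot.
have H i := lin_cvg_iterate i Ot.
have Hosc := @lin_cvg_osc0 R V t n (fun k s i => iterate k s i - ilimit s i).
have {H} Hs i : lin_cvg t (fun k s => iterate k s i - ilimit s i) (fun=> 0).
  have h := lin_cvg_sub (H i) (lin_cvg_const (lin_cvg_locally_bounded (H i))).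
  apply: (lin_cvg_near h); apply: nearW => s; split=> //.
  by rewrite subrr.
have [C [r [_ [C0 r0 r1 /nbhs_singleton[_ H]]]]] := Hosc Hs.
have dk k : osc (fun i => iterate k t i - ilimit t i) <= C * r ^+ k.
  by apply: le_trans (ler_norm _) _; rewrite -[X in `|X|]subr0; exact: H.
have dk' k : osc (fun i => ilimit t i - iterate k t i) <= C * r ^+ k.
  apply: le_trans (dk k); apply: osc_le => [|i j]; first exact: osc_ge0.
  apply: le_trans (le_osc _ j i); rewrite le_eqVlt; apply/orP; left.
  by apply/eqP; ring.
apply: (@le0_geometric _ _ (C + C) r) => // k.
have -> : y = (fun i => (scaling (ilimit t) (c t) (a t) (b t) i -
    iterate k.+1 t i) + (iterate k.+1 t i - ilimit t i)).
  by apply/funext => i; rewrite subrKA.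
apply: le_trans (osc_add _ _) _; rewrite mulrDl; apply: lerD.
  apply: le_trans (osc_scaling _ _ n0 m0 (a0 Ot) (b0 Ot) cM) _.
  apply: le_trans (dk' k); rewrite ler_piMl ?osc_ge0 //; exact: ltW.
apply: le_trans (dk k.+1) _; apply: ler_wpM2l => //.
by rewrite exprS ler_piMl ?exprn_ge0 //; exact: ltW.
Qed.

Lemma lcoupling_row_sum t i : O t -> \sum_j lcoupling t i j = a t i.
Proof.
move=> Ot; apply: invr_inj.
rewrite (coupling_rowV _ _ m0 (a0 Ot i) (b0 Ot)) scaling_ilimit //.
by rewrite subrr expR0 mul1r.
Qed.

End Iteration.

(** * Convergence of the derivatives of the iterates *)

Section DerivativeLimit.
Context {R : realType} {V : normedModType R} {n m : nat} (O : set V).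
Context (n0 : (0 < n)%N) (m0 : (0 < m)%N) (oO : open O).
Context (c : V -> 'I_n -> 'I_m -> R) (dc : V -> V -> 'I_n -> 'I_m -> R).
Context (a : V -> 'I_n -> R) (da : V -> V -> 'I_n -> R).
Context (b : V -> 'I_m -> R) (db : V -> V -> 'I_m -> R).
Context (x0 : V -> 'I_n -> R) (dx0 : V -> V -> 'I_n -> R).
Context (Hc : forall l j, C1_with O (fun s => c s l j) (fun s v => dc s v l j)).
Context (Ha : forall l, C1_with O (fun s => a s l) (fun s v => da s v l)).
Context (Hb : forall j, C1_with O (fun s => b s j) (fun s v => db s v j)).
Context (Hx0 : forall l, C1_with O (fun s => x0 s l) (fun s v => dx0 s v l)).
Context (a0 : forall t, O t -> forall i, 0 < a t i).
Context (b0 : forall t, O t -> forall j, 0 < b t j).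
Context (ab : forall t, O t -> \sum_i a t i = \sum_j b t j).

Local Notation iterate := (iterate c a b x0).
Local Notation icoupling := (icoupling c a b x0).
Local Notation diterate := (diterate c dc a da b db x0 dx0).
Local Notation ilimit := (ilimit c a b x0).
Local Notation lcoupling := (lcoupling c a b x0).

Context (t0 : V) (Ot0 : O t0) (v : V).

Let nearO : \forall t \near t0, O t.
Proof. exact: open_nbhs_nbhs. Qed.

Let lin_const (f : V -> R) : {for t0, continuous f} ->
  lin_cvg t0 (fun=> f) f.
Proof.
by move=> Hf; apply: lin_cvg_const; exact: continuous_locally_bounded.
Qed.

Let cont_b j : {for t0, continuous (fun t => b t j)}.
Proof. exact: C1_with_continuous (Hb j) Ot0. Qed.

Let cont_db j : {for t0, continuous (fun t => db t v j)}.
Proof. by have [_ h] := Hb j; exact: h. Qed.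

Let cont_dc i j : {for t0, continuous (fun t => dc t v i j)}.
Proof. by have [_ h] := Hc i j; exact: h. Qed.

Let cont_bV j : {for t0, continuous (fun t => (b t j)^-1)}.
Proof. by apply: continuous_at_inv; rewrite ?gt_eqF ?b0. Qed.

Let cont_a i : {for t0, continuous (fun t => a t i)}.
Proof. exact: C1_with_continuous (Ha i) Ot0. Qed.

Let cont_da i : {for t0, continuous (fun t => da t v i)}.
Proof. by have [_ h] := Ha i; exact: h. Qed.

Let cont_aV i : {for t0, continuous (fun t => (a t i)^-1)}.
Proof. by apply: continuous_at_inv; rewrite ?gt_eqF ?a0. Qed.

Let lin_x i : lin_cvg t0 (fun k t => iterate k t i) (fun t => ilimit t i).
Proof. exact: (lin_cvg_iterate n0 m0 oO Hc Ha Hb Hx0 a0 b0 ab). Qed.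

Lemma lin_cvg_icoupling i j :
  lin_cvg t0 (fun k t => icoupling k t i j) (fun t => lcoupling t i j).
Proof.
have lin_c l : lin_cvg t0 (fun _ t => c t l j) (fun t => c t l j).
  by apply: lin_const; exact: C1_with_continuous (Hc l j) Ot0.
pose D (x : 'I_n -> R) t := \sum_l expR (x l - c t l j - (x i - c t i j)).
have HD : lin_cvg t0 (fun k t => D (iterate k t) t) (fun t => D (ilimit t) t).
  apply: lin_cvg_sum => l; apply: lin_cvg_exp.
  by apply: lin_cvg_sub; (apply: lin_cvg_sub; [exact: lin_x|exact: lin_c]).
have D1 x t : 1 <= D x t.
  rewrite /D (bigD1 i) //= subrr expR0 lerDl.
  by apply: sumr_ge0 => l _; exact: expR_ge0.
have HV : lin_cvg t0 (fun k t => (D (iterate k t) t)^-1)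
    (fun t => (D (ilimit t) t)^-1).
  by apply: (lin_cvg_inv ltr01 _ HD); apply: nearW => t; split.
apply: (lin_cvg_near (lin_cvg_mul (lin_const (@cont_b j)) HV)).
by apply: nearW => t; split=> [|k]; rewrite -coupling_ratio.
Qed.

Lemma lin_cvg_row i : lin_cvg t0 (fun k t => (\sum_j icoupling k t i j)^-1)
  (fun t => (\sum_j lcoupling t i j)^-1).
Proof.
have H := lin_cvg_mul
  (lin_cvg_exp (lin_cvg_sub (lin_cvg_shift (lin_x i)) (lin_x i)))
  (lin_const (@cont_aV i)).
apply: (lin_cvg_near H); apply: filterS nearO => t Ot; split=> [|k].
  rewrite subrr expR0 mul1r.
  by rewrite (lcoupling_row_sum n0 m0 oO Hc Ha Hb Hx0 a0 b0 ab).
by rewrite (coupling_rowV _ _ m0 (a0 Ot i) (b0 Ot)).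
Qed.

Let mean_rate (z : nat -> V -> 'I_n -> R) (zbar : V -> 'I_n -> R) j :
  (forall l, lin_cvg t0 (fun k t => z k t l) (fun t => zbar t l)) ->
  lin_cvg t0
    (fun k t => \sum_l icoupling k t l j / b t j * (z k t l - dc t v l j))
    (fun t => \sum_l lcoupling t l j / b t j * (zbar t l - dc t v l j)).
Proof.
move=> Hz; apply: lin_cvg_sum => l; apply: lin_cvg_mul; last first.
  by apply: lin_cvg_sub => //; exact: lin_const.
by apply: lin_cvg_mul; [exact: lin_cvg_icoupling|exact: lin_const].
Qed.

Lemma lin_cvg_dcoupling (z : nat -> V -> 'I_n -> R) (zbar : V -> 'I_n -> R)
    i j :
  (forall l, lin_cvg t0 (fun k t => z k t l) (fun t => zbar t l)) ->
  lin_cvg t0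
    (fun k t => dcoupling (icoupling k t) (b t) (z k t) (dc t v) (db t v) i j)
    (fun t => dcoupling (lcoupling t) (b t) (zbar t) (dc t v) (db t v) i j).
Proof.
move=> Hz; apply: lin_cvg_mul; first exact: lin_cvg_icoupling.
apply: lin_cvg_sub; last exact: mean_rate.
apply: lin_cvg_add; first by apply: lin_cvg_sub => //; exact: lin_const.
by apply: lin_const; exact: continuous_at_mul.
Qed.

Lemma lin_cvg_dscaling (z : nat -> V -> 'I_n -> R) (zbar : V -> 'I_n -> R) i :
  (forall l, lin_cvg t0 (fun k t => z k t l) (fun t => zbar t l)) ->
  lin_cvg t0
    (fun k t => dscaling (icoupling k t) (a t) (b t) (z k t)
                  (dc t v) (da t v) (db t v) i)
    (fun t => dscaling (lcoupling t) (a t) (b t) (zbar t)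
                  (dc t v) (da t v) (db t v) i).
Proof.
move=> Hz; apply: lin_cvg_add.
  by apply: lin_const; exact: continuous_at_mul.
apply: lin_cvg_mul; first exact: lin_cvg_row.
apply: lin_cvg_sum => j; apply: lin_cvg_mul; first exact: lin_cvg_icoupling.
apply: lin_cvg_add; last exact: mean_rate.
by apply: lin_const; apply: continuous_at_sub => //; exact: continuous_at_mul.
Qed.

(* [J] solves the differentiated fixed-point equation modulo constants.  It is
   replaced by its normalisation [J'], which has the same oscillation and is
   bounded by it, hence locally bounded. *)
Context (J : V -> 'I_n -> R).
Let force t i := dscaling (lcoupling t) (a t) (b t) (fun=> 0)
  (dc t v) (da t v) (db t v) i.
Context (HJ : forall t, O t -> forall i i',
  dscaling (lcoupling t) (a t) (b t) (J t) (dc t v) (da t v) (db t v) i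
    - J t i =
  dscaling (lcoupling t) (a t) (b t) (J t) (dc t v) (da t v) (db t v) i'
    - J t i').

Let i0 : 'I_n := Ordinal n0.
Let J' t i := J t i - J t i0.

Let lcoupling_col t j : O t -> \sum_i lcoupling t i j = b t j.
Proof. by move=> Ot; exact: coupling_col_sum. Qed.

(* The equation gives [osc J <= q * osc J + osc force] with [q < 1]. *)
Let osc_J_le : locally_bounded t0 (fun t => osc (J t)).
Proof.
have lin0 (l : 'I_n) : lin_cvg t0 (fun (k : nat) (t : V) => 0 : R) (fun=> 0).
  by apply: lin_const; exact: cst_continuous.
have [D D0 HD] := locally_bounded_fin (fun i => lin_cvg_locally_bounded
  (lin_cvg_dscaling (z := fun _ _ _ => 0) (zbar := fun _ _ => 0) i lin0)).
have [M [q0 q1 HM]] := near_contraction_factor oO Hc Ot0.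
set q := 1 - _ in q0 q1.
exists ((D + D) / (1 - q)).
apply: filterS2 HM HD => t [Ot cM] HD.
rewrite ger0_norm ?osc_ge0 // ler_pdivlMr ?subr_gt0 //.
suff : osc (J t) <= q * osc (J t) + (D + D) by lra.
have tq : osc (two_step (lcoupling t) (b t) (J t)) <= q * osc (J t).
  by apply: osc_two_step_coupling => //; exact: b0.
have fD : osc (force t) <= D + D by exact: osc_le_norm.
apply: osc_le => [|i i'].
  by apply: addr_ge0; [apply: mulr_ge0 => //; exact: osc_ge0|exact: addr_ge0].
apply: le_trans
  (lerD (le_trans (le_osc _ i i') tq) (le_trans (le_osc _ i i') fD)).
have := HJ Ot i i'; rewrite dscaling_two_step -/(force t i).
by rewrite [in RHS]dscaling_two_step -/(force t i'); lra.
Qed.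

(** The contraction controls differences of entries only, so the derivative of
    the iterates is compared with [J] modulo constants. *)
Let lin_cvg_diterate i :
  lin_cvg t0 (fun k t => diterate k t v i - diterate k t v i0)
    (fun t => J' t i).
Proof.
have lbJ' l : locally_bounded t0 (fun t => J' t l).
  have [D HD] := osc_J_le; exists D; apply: filterS HD => t.
  apply: le_trans; rewrite [`|osc _|]ger0_norm ?osc_ge0 // ler_norml.
  by have := le_osc (J t) l i0; have := le_osc (J t) i0 l; rewrite /J'; lra.
have [M [q0 q1 HM]] := near_contraction_factor oO Hc Ot0.
set q := 1 - _ in q0 q1.
pose e k t := osc (fun l => diterate k t v l - J' t l).
pose F t p l := dscaling p (a t) (b t) (J' t) (dc t v) (da t v) (db t v) l.
(* [e] measures the error, and [d] the consistency error made by evaluating the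
   derivative of the map at the current coupling instead of the limit. *)
pose d k t := osc (fun l => F t (icoupling k t) l - F t (lcoupling t) l).
have Hd : lin_cvg t0 d (fun=> 0).
  apply: lin_cvg_osc0 => l.
  have h := lin_cvg_dscaling l (fun l => lin_cvg_const (lbJ' l)).
  have h' := lin_cvg_sub h (lin_cvg_const (lin_cvg_locally_bounded h)).
  by apply: (lin_cvg_near h'); apply: nearW => t; split=> //; rewrite subrr.
have HF t : O t -> forall l l', F t (lcoupling t) l - J' t l =
    F t (lcoupling t) l' - J' t l'.
  move=> Ot l l'; have := HJ Ot l l'.
  rewrite /F dscaling_two_step [in RHS]dscaling_two_step.
  rewrite [in X in _ -> X]dscaling_two_step.
  rewrite [in X in _ -> _ = X]dscaling_two_step.
  have sh k : two_step (lcoupling t) (b t) (J' t) k =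
      two_step (lcoupling t) (b t) (J t) k - J t i0.
    rewrite -two_step_shift //; first exact: b0.
    - by move=> j; exact: lcoupling_col.
    - by apply: coupling_row_gt0 => //; exact: b0.
  by rewrite !sh /J'; lra.
have He : lin_cvg t0 e (fun=> 0).
  apply: (lin_cvg_recursion q0 q1 _ Hd).
    have lb l : locally_bounded t0 (fun t => dx0 t v l - J' t l).
      have h : locally_bounded t0 (fun t => dx0 t v l).
        by apply: continuous_locally_bounded; have [_ h] := Hx0 l; exact: h.
      exact: (lin_cvg_locally_bounded
        (lin_cvg_sub (lin_cvg_const h) (lin_cvg_const (lbJ' l)))).
    have [D D0 HD] := locally_bounded_fin lb.
    exists (D + D); apply: filterS HD => t HD.
    by rewrite ger0_norm ?osc_ge0 //; exact: osc_le_norm.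
  apply: filterS HM => t [Ot cM] k; split; first exact: osc_ge0.
  have tq : osc (two_step (icoupling k t) (b t)
      (fun l => diterate k t v l - J' t l)) <= q * e k t.
    by apply: osc_two_step_coupling => //; exact: b0.
  have split_two_step l : two_step (icoupling k t) (b t) (diterate k t v) l =
      two_step (icoupling k t) (b t) (fun l => diterate k t v l - J' t l) l +
      two_step (icoupling k t) (b t) (J' t) l.
    rewrite /two_step -mulrDr -big_split /=; congr (_ * _).
    apply: eq_bigr => j _; rewrite -mulrDr -big_split /=; congr (_ * _).
    by apply: eq_bigr => l' _; ring.
  apply: osc_le => [|l l'].
    by apply: addr_ge0; [apply: mulr_ge0 => //; exact: osc_ge0|exact: osc_ge0].
  apply: le_trans (lerD (le_trans (le_osc _ l l') tq) (le_osc _ l l')).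
  have hF := HF t Ot l l'.
  have Ek l1 : F t (icoupling k t) l1 =
      two_step (icoupling k t) (b t) (J' t) l1 +
      dscaling (icoupling k t) (a t) (b t) (fun=> 0)
        (dc t v) (da t v) (db t v) l1.
    exact: dscaling_two_step.
  rewrite !Ek /= dscaling_two_step.
  rewrite [X in _ - (X - _) <= _]dscaling_two_step !split_two_step.
  by lra.
apply: (lin_cvg_squeeze (lbJ' i) He).
apply: nearW => t k; rewrite ler_norml /J'.
have := le_osc (fun l => diterate k t v l - J' t l) i i0.
have := le_osc (fun l => diterate k t v l - J' t l) i0 i.
by rewrite -/(e k t) /J'; lra.
Qed.

Lemma lin_cvg_dicoupling i j : lin_cvg t0
  (fun k t => dcoupling (icoupling k t) (b t) (diterate k t v)
                (dc t v) (db t v) i j)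
  (fun t => dcoupling (lcoupling t) (b t) (J t) (dc t v) (db t v) i j).
Proof.
apply: (lin_cvg_near (lin_cvg_dcoupling i j lin_cvg_diterate)).
apply: filterS nearO => t Ot; split=> [|k].
  by apply: dcoupling_shift => [|k]; [exact: b0|exact: lcoupling_col].
by apply: dcoupling_shift => [|k']; [exact: b0|exact: coupling_col_sum].
Qed.

End DerivativeLimit.

(** * Differentiating a limit term by term *)

Section UniformLimitOfDerivatives.
Context {R : realType} {p : nat} (O : set 'cV[R]_p).
Context (oO : open O).
Context (f : nat -> 'cV[R]_p -> R) (df : nat -> 'cV[R]_p -> 'cV[R]_p -> R).
Context (flim : 'cV[R]_p -> R) (g : 'cV[R]_p -> 'cV[R]_p -> R).
Context (Hf : forall k, C1_with O (f k) (df k)).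
Context (ff : forall t, O t -> f ^~ t @ \oo --> flim t).
Context (Hg : forall t v, O t ->
  lin_cvg t (fun k s => df k s v) (fun s => g s v)).

Let df_linear k t : O t -> exists L : {linear 'cV[R]_p -> R}, df k t = L.
Proof.
by move=> Ot; have [/(_ t Ot) [_ <-] _] := Hf k; exists ('d (f k) t).
Qed.

Let cvg_g t v : O t -> (fun k => df k t v) @ \oo --> g t v.
Proof. by move=> Ot; exact: lin_cvg_cvg (Hg v Ot). Qed.

Let g_linear t : O t -> linear (g t).
Proof.
move=> Ot k u v.
have h : (fun i => k * df i t u + df i t v) @ \oo --> k * g t u + g t v.
  by apply: cvgD; [apply: cvgMl_tmp|]; exact: cvg_g.
have E : (fun i => df i t (k *: u + v)) = (fun i => k * df i t u + df i t v).
  by apply/funext => i; have [L ->] := df_linear i Ot; rewrite linearP.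
rewrite -[RHS](cvg_lim _ h) // -E; apply/esym; apply: cvg_lim => //.
exact: (@cvg_g t _ Ot).
Qed.

Let g_coord t v : O t -> g t v = \sum_l v l 0 * g t (delta_mx l 0).
Proof.
move=> Ot; pose gM := GRing.isLinear.Build _ _ _ _ _ (g_linear Ot).
pose gL : {linear 'cV[R]_p -> R} := HB.pack (g t) gM.
rewrite -[g t]/(gL : 'cV[R]_p -> R) {1}[v]matrix_sum_delta linear_sum.
by apply: eq_bigr => l _; rewrite big_ord1 linearZ.
Qed.

Let continuous_g t v : O t -> {for t, continuous (fun s => g s v)}.
Proof.
move=> Ot; apply/(@cvgrPdist_le _ _ _ (nbhs t)) => e e0.
have [c [r [M [c0 r0 r1 H]]]] := Hg v Ot.
have e3 : 0 < e / 3 by rewrite divr_gt0.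
have : geometric c r @ \oo --> 0 by apply: cvg_geometric; rewrite ger0_norm.
move=> /cvgr_le /(_ _ e3) [k _ /(_ k (leqnn k)) /= ck].
have [_ /(_ v t Ot)] := Hf k; move=> /cvgrPdist_le /(_ _ e3) Hk.
have [_ Ht] := nbhs_singleton H.
apply: filterS2 H Hk => s [_ Hs] Hk.
have -> : g t v - g s v = (df k t v - df k s v) - (df k t v - g t v)
   + (df k s v - g s v) by ring.
have := le_trans (Hs k) ck; have := le_trans (Ht k) ck; have := Hk.
by rewrite !ler_norml => /andP[? ?] /andP[? ?] /andP[? ?]; lra.
Qed.

Let mean_value k t h : (forall s, 0 <= s <= 1 -> O (t + s *: h)) ->
  exists2 s, 0 <= s <= 1 & f k (t + h) - f k t = df k (t + s *: h) h.
Proof.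
move=> Oseg; pose w (s : R) := t + s *: h.
have dw (s : R) : is_diff s w (fun v => v *: h).
  apply: is_diff_ext
    (is_diffD (is_diff_cst t s) (is_diff_scalel s h)) _ => v /=.
  by rewrite add0r.
have D (s : R) : s \in `]0, 1[%R -> is_derive s 1 (f k \o w) (df k (w s) h).
  rewrite in_itv /= => /andP[s0 s1].
  have Ow : O (w s) by apply: Oseg; rewrite !ltW.
  have [/(_ _ Ow) Hk _] := Hf k.
  by have := is_derive_is_diff (is_diff_comp (dw s) Hk); rewrite /= scale1r.
have hc : {within `[0, 1], continuous (f k \o w)}.
  apply: derivable_within_continuous => s; rewrite in_itv /= => s01.
  have Ow : O (w s) by apply: Oseg.
  have [/(_ _ Ow) Hk _] := Hf k.
  by case: (is_derive_is_diff (is_diff_comp (dw s) Hk)).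
have [s s01] := MVT (@ltr01 R) D hc.
rewrite /= /w scale1r scale0r addr0 subr0 mulr1 => E.
by exists s => //; move: s01; rewrite in_itv /= => /andP[? ?]; rewrite !ltW.
Qed.

(** Differentiability of the limit: the mean value theorem bounds the Taylor
    remainder of [f k] by the oscillation of [df k], which is that of [g] up to
    an error that vanishes uniformly on a ball; then [k] tends to infinity. *)
Lemma C1_with_limit : C1_with O flim g.
Proof.
split=> [t Ot|v t Ot]; last exact: continuous_g.
pose gM := GRing.isLinear.Build _ _ _ _ _ (g_linear Ot).
pose gL : {linear 'cV[R]_p -> R} := HB.pack (g t) gM.
have gLE : g t = gL by [].
have gc : continuous gL.
  move=> v; rewrite -gLE (_ : g t = fun v => \sum_l v l 0 * g t (delta_mx l 0)).
    apply: continuous_at_sum => l; apply: continuous_at_mul.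
      exact: coord_continuous.
    exact: cst_continuous.
  by apply/funext => u; exact: g_coord.
suff E : flim \o shift t = cst (flim t) + gL +o_ 0 id.
  have dE := diff_unique gc E.
  apply: DiffDef; last by rewrite dE.
  by apply/diff_locallyP; rewrite dE.
apply/eqaddoP => _ /posnumP[e].
(* The remainder collects [p] coordinates, each contributing at most [d]. *)
pose d := e%:num / p.+1%:R.
have d0 : 0 < d by rewrite divr_gt0.
have /choice[cr Hcr] : forall l : 'I_p, exists cr : R * R,
    [/\ 0 <= cr.2, cr.2 < 1 & \forall s \near t, forall k,
     `|df k s (delta_mx l 0) - g s (delta_mx l 0)| <= cr.1 * cr.2 ^+ k].
  move=> l; have [c [r [M [_ r0 r1 H]]]] := Hg (delta_mx l 0) Ot.
  by exists (c, r); split=> //; apply: filterS H => s [].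
pose err k : R := \sum_l (cr l).1 * (cr l).2 ^+ k.
have err0 : err @ \oo --> 0.
  have -> : 0 = \sum_(l < p) (0 : R) by rewrite big1.
  apply: (@cvg_big _ _ +%R) => [|l _]; first exact: add_continuous.
  by apply: cvg_geometric; have [? ?] := Hcr l; rewrite ger0_norm.
have : \forall s \near t, [/\ O s,
    forall l, `|g t (delta_mx l 0) - g s (delta_mx l 0)| <= d &
    forall l k, `|df k s (delta_mx l 0) - g s (delta_mx l 0)| <= err k].
  have near1 : \forall s \near t, O s by exact: open_nbhs_nbhs.
  have near2 : \forall s \near t, forall l : 'I_p,
      `|g t (delta_mx l 0) - g s (delta_mx l 0)| <= d.
    apply: (@filter_forall _ 'I_p _ (nbhs t) _) => l.
    have := @continuous_g t (delta_mx l 0) Ot.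
    by move=> /(@cvgrPdist_le _ _ _ (nbhs t)); exact.
  have near3 : \forall s \near t, forall l : 'I_p, forall k,
      `|df k s (delta_mx l 0) - g s (delta_mx l 0)| <=
      (cr l).1 * (cr l).2 ^+ k.
    by apply: (@filter_forall _ 'I_p _ (nbhs t) _) => l; have [] := Hcr l.
  apply: filterS3 near1 near2 near3 => s Os gs dfs; split=> // l k.
  apply: le_trans (dfs l k) _; rewrite /err (bigD1 l) //= lerDl.
  by apply: sumr_ge0 => l' _; exact: le_trans (dfs l' k).
move=> /nbhs_normP[del /= del0 near_t].
near=> h.
have hdel : `|h| < del by near: h; exact: (@nbhs0_lt R 'cV[R]_p).
have seg s : 0 <= s <= 1 -> `|t - (t + s *: h)| < del.
  move=> /andP[s0 s1]; rewrite opprD addNKr normrN normrZ ger0_norm //.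
  by apply: le_lt_trans hdel; rewrite ler_piMl.
have Oseg s : 0 <= s <= 1 -> O (t + s *: h) by move=> /seg /near_t[].
have rem k : `|f k (t + h) - f k t - g t h| <= p%:R * (d + err k) * `|h|.
  have [s /[dup] s01 /seg /near_t[Os gs dfs] ->] := mean_value k Oseg.
  have -> : df k (t + s *: h) h - g t h =
    \sum_l h l 0 * (df k (t + s *: h) (delta_mx l 0) - g t (delta_mx l 0)).
    rewrite (g_coord h Ot).
    have [L dfL] := df_linear k Os.
    rewrite dfL {1}[h]matrix_sum_delta linear_sum.
    rewrite -sumrB; apply: eq_bigr => l _.
    by rewrite big_ord1 linearZ mulrBr.
  apply: le_trans (ler_norm_sum _ _ _) _.
  have -> : p%:R * (d + err k) * `|h| = \sum_(l < p) (`|h| * (d + err k)).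
    by rewrite sumr_const card_ord -mulr_natl; ring.
  apply: ler_sum => l _; rewrite normrM; apply: ler_pM => //.
    rewrite [leRHS]/Num.Def.normr /= mx_normrE.
    exact: (le_bigmax _ (fun ij : 'I_p * 'I_1 => `|h ij.1 ij.2|) (l, 0)).
  have -> : df k (t + s *: h) (delta_mx l 0) - g t (delta_mx l 0) =
    - (g t (delta_mx l 0) - g (t + s *: h) (delta_mx l 0)) +
    (df k (t + s *: h) (delta_mx l 0) - g (t + s *: h) (delta_mx l 0)) by ring.
  by apply: le_trans (ler_normD _ _) _; rewrite normrN lerD.
have Oth : O (t + h) by rewrite -[h]scale1r; apply: Oseg; rewrite ler01 lexx.
have lim1 : (fun k => `|f k (t + h) - f k t - g t h|) @ \oo -->
    `|flim (t + h) - flim t - g t h|.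
  apply: cvg_norm; apply: cvgB; last exact: cvg_cst.
  by apply: cvgB; exact: ff.
have lim2 : (fun k => p%:R * (d + err k) * `|h|) @ \oo -->
    p%:R * (d + 0) * `|h|.
  apply: cvgMr_tmp; apply: cvgMl_tmp; apply: cvgD => //; exact: cvg_cst.
have le_lim : `|flim (t + h) - flim t - g t h| <= p%:R * (d + 0) * `|h|.
  apply: ler_cvg_to lim1 lim2 _; apply: nearW => k; exact: rem.
change (`|flim (h + t) - (flim t + g t h)| <= e%:num * `|h|).
rewrite opprD addrA [h + t]addrC.
apply: le_trans le_lim _; rewrite addr0 ler_wpM2r // /d mulrCA.
by rewrite ler_piMr // ler_pdivrMr // mul1r ler_nat.
Unshelve. all: by end_near. Qed.

End UniformLimitOfDerivatives.

(** * Diagonalization and the spectral pseudo-inverse *)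

Section RealSpectralTheorem.
Local Notation toC := (real_complex _).

(** The real minimal polynomial divides the product of [X - r] over the distinct
    real eigenvalues of the complexification, because that product annihilates
    the complexified matrix by the Hermitian spectral theorem. *)
Lemma symmetric_diagonalizable (R : rcfType) n (S : 'M[R]_n) :
  S^T = S -> diagonalizable S.
Proof.
case: n S => [|n] S Ssym.
  by exists 1%:M; rewrite ?unitmx1 //; apply/is_diag_mxP => -[].
have Sij i j : S i j = S j i by rewrite -{1}Ssym mxE.
pose SC := map_mx toC S.
have SCh : SC \is hermsymmx.
  apply: realsym_hermsym; last first.
    by apply/mxOverP => i j; rewrite mxE complex_real.
  apply/is_hermitianmxP; rewrite expr0 scale1r map_mx_id //.
  by apply/matrixP => i j; rewrite !mxE Sij.
have SCE := orthomx_spectralP (hermitian_normalmx SCh).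
set d := spectral_diag SC in SCE.
have dreal i : toC (complex.Re (d 0 i)) = d 0 i.
  apply: RRe_real.
  by have /mxOverP/(_ 0 i) := hermitian_spectral_diag_real SCh.
apply/diagonalizableP.
pose rs := undup [seq complex.Re (d 0 i) | i <- enum 'I_n.+1].
exists rs; first exact: undup_uniq.
apply: mxminpoly_min; apply: (map_mx_inj (f := toC)).
rewrite map_horner_mx map_mx0 -/SC SCE -[X in _ *m X]invmxK.
rewrite horner_mx_uconj ?unitmx_inv ?spectral_unit // horner_mx_diag.
set D := diag_mx _; suff -> : D = 0 by rewrite mulmx0 mul0mx.
apply/matrixP => i j; rewrite !mxE; case: eqP => // _; rewrite mulr1n.
rewrite -dreal horner_map (rootP _) ?rmorph0 // root_prod_XsubC mem_undup.
by apply/mapP; exists i; rewrite ?mem_enum.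
Qed.

(** Detailed balance makes [A] symmetric in the weighted inner product of
    weights [w]; conjugating by the square roots of the weights makes it
    symmetric. *)
Lemma detailed_balance_diagonalizable (R : rcfType) n (A : 'M[R]_n)
    (w : 'I_n -> R) : (forall i, 0 < w i) ->
  (forall i l, w i * A i l = w l * A l i) -> diagonalizable A.
Proof.
move=> w0 bal.
pose u := \row_i Num.sqrt (w i).
pose S := \matrix_(i, l) (u 0 i * A i l / u 0 l).
have u0 i : u 0 i != 0 by rewrite mxE gt_eqF // sqrtr_gt0.
have uu i : u 0 i * u 0 i = w i by rewrite mxE -expr2 sqr_sqrtr // ltW.
have Uu : diag_mx u \in unitmx.
  by rewrite unitmxE det_diag unitfE; apply/prodf_neq0 => i _.
have [Q Qu QS] : diagonalizable S.
  apply: symmetric_diagonalizable; apply/matrixP => i l.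
  rewrite [LHS]mxE [LHS]mxE [RHS]mxE; have := bal i l; rewrite -!uu.
  move: (u 0 i) (u 0 l) (u0 i) (u0 l) => x y x0 y0 h.
  apply: (mulIf x0); apply: (mulIf y0).
  have -> : y * A l i / x * x * y = y * y * A l i by field.
  by rewrite -h; field.
exists (Q *m diag_mx u); first by rewrite unitmx_mul Qu.
move: QS => /(diagonalizable_forPex)[D /(simmxP Qu) QSD].
apply/diagonalizable_forPex; exists D; apply/simmxP; rewrite ?unitmx_mul ?Qu //.
rewrite mulmxA -QSD -!mulmxA; congr (_ *m _).
apply/matrixP => i l; rewrite mul_diag_mx mul_mx_diag [LHS]mxE [RHS]mxE.
by rewrite [S i l]mxE divfK.
Qed.

End RealSpectralTheorem.

Section SpectralPseudoInverse.
Context {R : realType} {n : nat}.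
Implicit Types M N : 'M[R]_n.

Lemma spectral_pinvP M : diagonalizable M ->
  is_spectral_pinv M (spectral_pinv M).
Proof.
move=> [P Pu /(diagonalizable_forLR Pu)[D MD]].
suff /(xgetPex 0) : exists N, [set N | is_spectral_pinv M N] N by [].
exists (invmx P *m diag_mx (map_mx GRing.inv D) *m P); exists (invmx P), D.
split; first by rewrite unitmx_inv.
  by rewrite MD mxpoly.conjVmx // invmxK.
by rewrite invmxK.
Qed.

Lemma spectral_pinv_mulK M N : is_spectral_pinv M N -> M *m N *m M = M.
Proof.
move=> [Q [d [Qu -> ->]]].
rewrite !mulmxA mulmxKV // mulmxKV //; congr (_ *m _).
rewrite -!mulmxA; congr (_ *m _).
rewrite !mulmx_diag; congr diag_mx; apply/rowP => i; rewrite !mxE.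
have [->|d0] := eqVneq (d 0 i) 0; first by rewrite !mul0r.
by rewrite mulVf ?mulr1.
Qed.

Lemma spectral_pinvC M N : is_spectral_pinv M N -> M *m N = N *m M.
Proof.
move=> [Q [d [Qu -> ->]]].
rewrite !mulmxA !mulmxKV // -!(mulmxA Q) !mulmx_diag.
by congr (_ *m (diag_mx _ *m _)); apply/rowP => i; rewrite !mxE mulrC.
Qed.

(** [M N] is the projection onto the range of [M] along its kernel, so
    [N *m v] solves [M z = v] up to an element of the kernel. *)
Lemma spectral_pinv_solves M N q (v : 'M[R]_(n, q)) : is_spectral_pinv M N ->
  M *m (M *m (N *m v) - v) = 0.
Proof.
move=> MN; rewrite mulmxBr !mulmxA -[M *m M *m N]mulmxA (spectral_pinvC MN).
by rewrite mulmxA (spectral_pinv_mulK MN) subrr.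
Qed.

End SpectralPseudoInverse.

(** * Optimality of couplings in scaling form *)

Section EntropicOptimality.
Context {R : realType}.

Lemma relative_entropy_ge0 (q p : R) : 0 <= q -> 0 < p ->
  0 <= q * (ln q - ln p) - q + p.
Proof.
rewrite le_eqVlt => /predU1P[<-|q0] p0.
  by rewrite mul0r sub0r oppr0 add0r ltW.
have h : 1 + (ln p - ln q) <= expR (ln p - ln q) by exact: expR_ge1Dx.
rewrite expRB !lnK ?posrE // in h.
have : q * (1 + (ln p - ln q)) <= p.
  by rewrite mulrC -ler_pdivlMr.
lra.
Qed.

Lemma relative_entropy_eq0 (q p : R) : 0 <= q -> 0 < p ->
  q * (ln q - ln p) - q + p = 0 -> q = p.
Proof.
rewrite le_eqVlt => /predU1P[<-|q0] p0; first by lra.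
move=> E; apply: ln_inj; rewrite ?posrE //.
apply/eqP; rewrite eq_sym -subr_eq0; apply/negPn/negP => /expR_gt1Dx.
rewrite expRB !lnK ?posrE // ltr_pdivlMr //.
by apply/negP; rewrite -leNgt; lra.
Qed.

Context {n m : nat} (C : 'M[R]_(n, m)) (a : 'cV[R]_n) (b : 'cV[R]_m) (eps : R).
Context (eps0 : 0 < eps).

(** On the transport polytope the potentials [x] and [y] integrate to constants,
    so that [C] may be traded for [- eps * ln P] and the objective becomes a
    relative entropy with respect to [P]. *)
Lemma eot_objective_excess (P Q : 'M[R]_(n, m)) (x : 'I_n -> R)
    (y : 'I_m -> R) :
  transport_polytope a b P -> transport_polytope a b Q ->
  (forall i j, C i j + eps * ln (P i j) = eps * (x i + y j)) ->
  eot_objective C eps Q = eot_objective C eps P + eps *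
    \sum_i \sum_j (Q i j * (ln (Q i j) - ln (P i j)) - Q i j + P i j).
Proof.
move=> [_ Pa Pb] [_ Qa Qb] E.
have row (S : 'M[R]_(n, m)) : S *m const_mx 1 = a ->
    forall i, \sum_j S i j = a i 0.
  by move=> <- i; rewrite mxE; apply: eq_bigr => j _; rewrite mxE mulr1.
have col (S : 'M[R]_(n, m)) : S^T *m const_mx 1 = b ->
    forall j, \sum_i S i j = b j 0.
  by move=> <- j; rewrite mxE; apply: eq_bigr => i _; rewrite !mxE mulr1.
have pot (S : 'M[R]_(n, m)) : S *m const_mx 1 = a -> S^T *m const_mx 1 = b ->
    \sum_i \sum_j S i j * (x i + y j - 1) =
    \sum_i x i * a i 0 + \sum_j y j * b j 0 - \sum_i a i 0.
  move=> Sa Sb; under eq_bigr do under eq_bigr do rewrite mulrBr mulrDr mulr1.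
  under eq_bigr do rewrite sumrB big_split /= (row _ Sa) -mulr_suml (row _ Sa).
  rewrite sumrB big_split /=; congr (_ + _ - _).
    by apply: eq_bigr => i _; rewrite mulrC.
  rewrite exchange_big; apply: eq_bigr => j _.
  by rewrite -mulr_suml (col _ Sb) mulrC.
have obj (S : 'M[R]_(n, m)) : eot_objective C eps S =
    eps * (\sum_i \sum_j S i j * (x i + y j - 1) +
           \sum_i \sum_j S i j * (ln (S i j) - ln (P i j))).
  rewrite /eot_objective /Ent mulrN opprK mulrDr !mulr_sumr -!big_split /=.
  apply: eq_bigr => i _; rewrite !mulr_sumr -!big_split /=.
  apply: eq_bigr => j _.
  have -> : C i j = eps * (x i + y j) - eps * ln (P i j) by rewrite -E addrK.
  by ring.
have P0 : \sum_i \sum_j P i j * (ln (P i j) - ln (P i j)) = 0.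
  by rewrite big1 // => i _; rewrite big1 // => j _; rewrite subrr mulr0.
rewrite !obj (pot _ Pa Pb) (pot _ Qa Qb) P0 addr0 -mulrDr; congr (_ * (_ + _)).
apply: eq_bigr => i _.
by rewrite big_split sumrB /= (row _ Pa) (row _ Qa) subrK.
Qed.

Lemma eot_argmin_unique (P : 'M[R]_(n, m)) (x : 'I_n -> R) (y : 'I_m -> R) :
  transport_polytope a b P -> (forall i j, 0 < P i j) ->
  (forall i j, C i j + eps * ln (P i j) = eps * (x i + y j)) ->
  eot_argmin C a b eps = [set P].
Proof.
move=> HP P0 E; have excess Q HQ := @eot_objective_excess P Q x y HP HQ E.
have kl0 Q : transport_polytope a b Q -> forall i j,
    0 <= Q i j * (ln (Q i j) - ln (P i j)) - Q i j + P i j.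
  by move=> [Q0 _ _] i j; exact: relative_entropy_ge0.
have ge Q : transport_polytope a b Q ->
    eot_objective C eps P <= eot_objective C eps Q.
  move=> HQ; rewrite (excess _ HQ) lerDl mulr_ge0 ?(ltW eps0) //.
  by apply: sumr_ge0 => i _; apply: sumr_ge0 => j _; exact: kl0.
apply/seteqP; split=> [Q [HQ Qmin]|_ ->]; last by split.
have := Qmin _ HP; rewrite (excess _ HQ) gerDl pmulr_rle0 // => h.
have s0 i : 0 <= \sum_j (Q i j * (ln (Q i j) - ln (P i j)) - Q i j + P i j).
  by apply: sumr_ge0 => j _; exact: kl0.
have {}h :
    \sum_i \sum_j (Q i j * (ln (Q i j) - ln (P i j)) - Q i j + P i j) = 0.
  by apply/eqP; rewrite eq_le h sumr_ge0.
apply/matrixP => i j; have [Q0 _ _] := HQ.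
apply: relative_entropy_eq0 => //.
have h1 := psumr_eq0P (fun i _ => s0 i) h (i := i) isT.
exact: (psumr_eq0P (fun j _ => kl0 Q HQ i j) h1 (i := j) isT).
Qed.

End EntropicOptimality.

(** * Locality, quotients and Jacobians *)

Section LocalityAndQuotients.
Context {R : realType} {V : normedModType R}.

Lemma is_diff_near_eq (W : normedModType R) x (f g df : V -> W) :
  (\forall y \near x, f y = g y) -> is_diff x f df -> is_diff x g df.
Proof.
move=> E Hf; case: (Hf) => fx <-.
have fgx : f x = g x := nbhs_singleton E.
suff H : g \o shift x = cst (g x) + 'd f x +o_ 0 id.
  have h := diff_unique (diff_continuous fx) H.
  split; last exact: h.
  by apply/diff_locallyP; rewrite h; split=> //; exact: diff_continuous.
have /eqaddoP Ho := diff_locally fx; apply/eqaddoP => e e0.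
move/nbhs_normP : E => [d /= d0 Ed].
apply: filterS2 (nbhs0_lt d0) (Ho e e0) => h hd.
rewrite /= !fctE /= fgx Ed //=.
by rewrite opprD addrCA subrr addr0 normrN.
Qed.

Lemma C1_with_eq_on (W : normedModType R) (O : set V) (f g : V -> W)
    (df : V -> V -> W) : open O -> {in O, f =1 g} ->
  C1_with O f df -> C1_with O g df.
Proof.
move=> oO fg [Hf Hdf]; split=> // x Ox; apply: is_diff_near_eq (Hf x Ox).
have : \forall y \near x, O y by exact: open_nbhs_nbhs.
by apply: filterS => y Oy; apply: fg; rewrite inE.
Qed.

Lemma C1_with_div (O : set V) (f g : V -> R) (df dg : V -> V -> R) :
  (forall x, O x -> g x != 0) -> C1_with O f df -> C1_with O g dg ->
  C1_with O (fun x => f x / g x)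
    (fun x v => f x * (- (g x) ^- 2 * dg x v) + (g x)^-1 * df x v).
Proof.
move=> g0 Hf Hg; split=> [x Ox|v x Ox].
  apply: is_diff_mul; first by have [h _] := Hf; exact: h.
  by apply: is_diff_inv; [have [h _] := Hg; exact: h|exact: g0].
have fx := C1_with_continuous Hf Ox; have gx := C1_with_continuous Hg Ox.
have gVx : {for x, continuous (fun y => (g y)^-1)}.
  by apply: continuous_at_inv => //; exact: g0.
have [_ dfx] := Hf; have [_ dgx] := Hg.
apply: continuous_at_add; apply: continuous_at_mul => //; last exact: dfx.
apply: continuous_at_mul; last exact: dgx.
have -> : (fun y => - (g y) ^- 2) = (fun y => 0 - (g y)^-1 * (g y)^-1).
  by apply/funext => y; rewrite sub0r -exprVn expr2.
apply: continuous_at_sub; first exact: cst_continuous.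
exact: continuous_at_mul.
Qed.

End LocalityAndQuotients.

Section Jacobians.
Context {R : realType}.

Lemma jacobian_matrix_mul n q (f : 'cV[R]_q -> 'cV[R]_n) x (v : 'cV[R]_q) :
  jacobian_matrix f x *m v = 'd f x v.
Proof.
apply/colP => i; rewrite [in RHS](matrix_sum_delta v) linear_sum summxE mxE.
by apply: eq_bigr => l _; rewrite big_ord1 linearZ !mxE mulrC.
Qed.

Lemma tensor_mul_derivative n m q r (f : 'cV[R]_q -> 'M[R]_(n, m)) x
    (M : 'M[R]_(q, r)) l :
  tensor_mul (derivative_tensor f x) M 0 l = 'd f x (col l M).
Proof.
rewrite mxE [in RHS](matrix_sum_delta (col l M)) linear_sum.
by apply: eq_bigr => k _; rewrite big_ord1 linearZ !mxE.
Qed.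

Lemma jacobian_matrix_col n q (f : 'cV[R]_q -> 'cV[R]_n) x l :
  col l (jacobian_matrix f x) = 'd f x (delta_mx l 0).
Proof. by apply/colP => i; rewrite !mxE. Qed.

Lemma tensor_norm_sub_le n m q (T U : tensor3 R n m q)
    (tau ups : 'I_q -> 'I_n -> 'I_m -> R) (D : R) : 0 <= D ->
  (forall l i j, T 0 l i j = tau l i j) ->
  (forall l i j, U 0 l i j = ups l i j) ->
  (forall l i j, `|tau l i j - ups l i j| <= D) -> tensor_norm (T - U) <= D.
Proof.
move=> D0 HT HU H; apply: bigmax_le => // l _.
rewrite [X in X <= _]/Num.Def.normr /= mx_normrE.
apply: bigmax_le => // -[i j] _ /=.
rewrite [(T - U) 0 l]mxE [(- U) 0 l]mxE [X in `|X|]mxE [X in _ + X]mxE.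
by rewrite HT HU.
Qed.

Lemma cvg_tensor_entries n m q (T : nat -> tensor3 R n m q)
    (U : tensor3 R n m q) (tau : nat -> 'I_q -> 'I_n -> 'I_m -> R)
    (ups : 'I_q -> 'I_n -> 'I_m -> R) :
  (forall k l i j, T k 0 l i j = tau k l i j) ->
  (forall l i j, U 0 l i j = ups l i j) ->
  (forall l i j, (fun k => tau k l i j) @ \oo --> ups l i j) -> T @ \oo --> U.
Proof.
move=> HT HU H; apply: cvg_mx_entries => o l; rewrite ord1.
apply: cvg_mx_entries => i j; rewrite HU.
have -> : (fun k => T k 0 l i j) = (fun k => tau k l i j).
  by apply/funext => k; exact: HT.
exact: H.
Qed.

End Jacobians.

(** * Differentiability of the optimal coupling and of the Sinkhorn plans *)

Lemma simplex_dim_gt0 (R : realType) n (u : 'cV[R]_n) :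
  simplex u -> (0 < n)%N.
Proof.
by case: n u => [|//] u [_]; rewrite big_ord0 => /esym/eqP; rewrite oner_eq0.
Qed.

Section SinkhornEntries.
Context {R : realType} {n m : nat}.

Lemma sinkhorn_plan_entry (C : 'M[R]_(n, m)) (b : 'cV[R]_m) eps x i j :
  sinkhorn_plan C b eps x i j =
  coupling (fun l => x l 0) (fun l k => C l k / eps) (fun k => b k 0) i j.
Proof.
rewrite /sinkhorn_plan mul_mx_diag mxE mul_diag_mx mxE !mxE.
rewrite /coupling /softmax mulrCA mulNr -expRD; congr (_ * (_ / _)).
by apply: eq_bigr => l _; rewrite !mxE mulNr -expRD addrC.
Qed.

Lemma sinkhorn_map_entry (C : 'M[R]_(n, m)) (a : 'cV[R]_n) (b : 'cV[R]_m)
    eps x i : (0 < m)%N -> (forall j, 0 < b j 0) ->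
  sinkhorn_map C a b eps x i 0 =
  scaling (fun l => x l 0) (fun l k => C l k / eps) (fun l => a l 0)
    (fun k => b k 0) i.
Proof.
move=> m0 b0; rewrite /sinkhorn_map /scaling !mxE.
set S := \sum_j coupling _ _ _ _ _; set T := \sum_j _.
have S0 : 0 < S by exact: coupling_row_gt0.
have ST : S = expR (x i 0) * T.
  rewrite /S /T mulr_sumr; apply: eq_bigr => j _.
  rewrite -sinkhorn_plan_entry /sinkhorn_plan mul_mx_diag mxE mul_diag_mx mxE.
  by rewrite !mxE [RHS]mulrA.
have T0 : 0 < T by rewrite -(pmulr_rgt0 _ (expR_gt0 (x i 0))) -ST.
by rewrite ST lnM ?posrE ?expR_gt0 // expRK; ring.
Qed.

(** The first-order optimality condition, the bracket being the dual potential
    of column [j]. *)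
Lemma coupling_potentials (C : 'M[R]_(n, m)) (b : 'cV[R]_m) eps
    (x : 'I_n -> R) i j : 0 < eps -> (forall j, 0 < b j 0) ->
  let c l k := C l k / eps in
  C i j + eps * ln (coupling x c (fun k => b k 0) i j) =
  eps * (x i + (ln (b j 0) - ln (\sum_l expR (x l - c l j)))).
Proof.
move=> eps0 b0 c; rewrite /coupling /softmax.
set S := \sum_l _; have S0 : 0 < S by exact: (sum_expR_gt0 _ i).
rewrite lnM ?posrE ?divr_gt0 ?expR_gt0 // ln_div ?posrE ?expR_gt0 // expRK /c.
by field; rewrite gt_eqF.
Qed.

Lemma eot_argmin_coupling (C : 'M[R]_(n, m)) (a : 'cV[R]_n) (b : 'cV[R]_m) eps
    (x : 'I_n -> R) : (0 < n)%N -> 0 < eps -> (forall j, 0 < b j 0) ->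
  let p := coupling x (fun l k => C l k / eps) (fun k => b k 0) in
  (forall i, \sum_j p i j = a i 0) ->
  eot_argmin C a b eps = [set \matrix_(i, j) p i j].
Proof.
move=> n0 eps0 b0 p pa.
have p0 i j : 0 < p i j by exact: coupling_gt0.
apply: (@eot_argmin_unique _ _ _ C a b eps eps0 _ x
  (fun j => ln (b j 0) - ln (\sum_l expR (x l - C l j / eps)))).
- split=> [i j||].
  + by rewrite mxE ltW.
  + apply/colP => i; rewrite mxE -pa; apply: eq_bigr => j _.
    by rewrite !mxE mulr1.
  + apply/colP => j; rewrite mxE -[RHS](coupling_col_sum x
      (fun l k => C l k / eps) (fun k => b k 0) j n0).
    by apply: eq_bigr => i _; rewrite !mxE mulr1.
- by move=> i j; rewrite mxE.
by move=> i j; rewrite mxE; exact: coupling_potentials.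
Qed.

End SinkhornEntries.

Section SinkhornDerivatives.
Context {R : realType} {n m p : nat} (Omega : set 'cV[R]_p).
Context (C : 'cV[R]_p -> 'M[R]_(n, m)) (a : 'cV[R]_p -> 'cV[R]_n).
Context (b : 'cV[R]_p -> 'cV[R]_m) (eps : 'cV[R]_p -> R).
Context (x0 : 'cV[R]_p -> 'cV[R]_n).
Context (Omega_open : open Omega).
Context (C_C1 : C1_on Omega C) (a_C1 : C1_on Omega a) (b_C1 : C1_on Omega b).
Context (eps_C1 : C1_on Omega eps) (x0_C1 : C1_on Omega x0).
Context (ab1 : forall t, Omega t -> \sum_i a t i 0 = \sum_j b t j 0).
Context (a_gt0 : forall t, Omega t -> forall i, 0 < a t i 0).
Context (b_gt0 : forall t, Omega t -> forall j, 0 < b t j 0).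
Context (eps_gt0 : forall t, Omega t -> 0 < eps t).
Context (n0 : (0 < n)%N) (m0 : (0 < m)%N).

Let F (x : 'cV[R]_n) t := sinkhorn_map (C t) (a t) (b t) (eps t) x.
Let P (x : 'cV[R]_n) t := sinkhorn_plan (C t) (b t) (eps t) x.
Let Phat t := eot_plan (C t) (a t) (b t) (eps t).
Let x_ k t := iter k (fun x => F x t) (x0 t).
Let xbar t := lim (x_ ^~ t @ \oo).
Let P_ k t := P (x_ k t) t.
Let A t := jacobian_matrix (fun x => F x t) (xbar t).
Let B t := jacobian_matrix (fun s => F (xbar t) s) t.

Let ce t i j := C t i j / eps t.
Let ae t i := a t i 0.
Let be t j := b t j 0.
Let x0e t i := x0 t i 0.
Let dce t v i j := C t i j * (- (eps t) ^- 2 * 'd eps t v)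
  + (eps t)^-1 * 'd C t v i j.
Let dae t v i := ('d a t v : 'cV[R]_n) i 0.
Let dbe t v j := ('d b t v : 'cV[R]_m) j 0.
Let dx0e t v i := ('d x0 t v : 'cV[R]_n) i 0.

Let Hc i j : C1_with Omega (fun t => ce t i j) (fun t v => dce t v i j).
Proof.
apply: C1_with_div; first by move=> t Ot; rewrite gt_eqF ?eps_gt0.
  exact: C1_on_entry.
by apply/C1_onP.
Qed.

Let Ha i : C1_with Omega (fun t => ae t i) (fun t v => dae t v i).
Proof. exact: C1_on_entry. Qed.

Let Hb j : C1_with Omega (fun t => be t j) (fun t v => dbe t v j).
Proof. exact: C1_on_entry. Qed.

Let Hx0 i : C1_with Omega (fun t => x0e t i) (fun t v => dx0e t v i).
Proof. exact: C1_on_entry. Qed.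

Let xe := iterate ce ae be x0e.
Let pe := icoupling ce ae be x0e.
Let xl := ilimit ce ae be x0e.
Let pl := lcoupling ce ae be x0e.
Let dxe := diterate ce dce ae dae be dbe x0e dx0e.

Let x_E k t i : Omega t -> x_ k t i 0 = xe k t i.
Proof.
move=> Ot; elim: k i => [//|k IH] i.
rewrite /= /F sinkhorn_map_entry //; last exact: b_gt0.
by congr (scaling _ _ _ _ _); apply/funext => l; exact: IH.
Qed.

Let P_E k t i j : Omega t -> P_ k t i j = pe k t i j.
Proof.
move=> Ot; rewrite /P_ /P sinkhorn_plan_entry.
have -> : (fun l => x_ k t l 0) = xe k t by apply/funext => l; exact: x_E.
by [].
Qed.

Let cvg_x t : Omega t -> x_ ^~ t @ \oo --> \col_i xl t i.
Proof.
move=> Ot; apply: cvg_mx_entries => i j; rewrite ord1 mxE.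
have -> : (fun k => x_ k t i 0) = (fun k => xe k t i).
  by apply/funext => k; exact: x_E.
exact: (cvg_iterate n0 m0 Omega_open Hc Ha Hb Hx0 a_gt0 b_gt0 ab1).
Qed.

Let xbarE t : Omega t -> xbar t = \col_i xl t i.
Proof. by move=> Ot; apply: cvg_lim => //; exact: cvg_x. Qed.

Let xbar_entries t : Omega t -> (fun l => xbar t l 0) = xl t.
Proof. by move=> Ot; apply/funext => i; rewrite xbarE // mxE. Qed.

Let rowE t i : Omega t -> \sum_j pl t i j = a t i 0.
Proof.
exact: (lcoupling_row_sum n0 m0 Omega_open Hc Ha Hb Hx0 a_gt0 b_gt0 ab1).
Qed.

Let argminE t : Omega t ->
  eot_argmin (C t) (a t) (b t) (eps t) = [set \matrix_(i, j) pl t i j].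
Proof.
move=> Ot; apply: eot_argmin_coupling => //; first exact: eps_gt0.
- exact: b_gt0.
- by move=> i; exact: rowE.
Qed.

Let PhatE t i j : Omega t -> Phat t i j = pl t i j.
Proof.
move=> Ot; rewrite /Phat /eot_plan argminE //.
have := @xgetPex _ 0 [set \matrix_(i, j) pl t i j].
by move=> /(_ (ex_intro _ _ erefl)) ->; rewrite mxE.
Qed.

Lemma eot_argminE t : Omega t ->
  eot_argmin (C t) (a t) (b t) (eps t) = [set Phat t].
Proof.
move=> Ot; rewrite argminE //; congr [set _].
by apply/matrixP => i j; rewrite PhatE // mxE.
Qed.

Lemma cvg_sinkhorn t : Omega t -> x_ ^~ t @ \oo --> xbar t.
Proof. by move=> Ot; rewrite xbarE //; exact: cvg_x. Qed.

Let is_diff_const (V : normedModType R) (s : V) (k : R) :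
  is_diff s (fun=> k) (fun=> 0).
Proof. exact: is_diff_cst. Qed.

Let is_diff_coord (s : 'cV[R]_n) l :
  is_diff s (fun y => y l 0) (fun v => v l 0).
Proof. exact: (is_diff_entry l 0 (is_diff_id s)). Qed.

Let is_diff_F_x t : Omega t -> is_diff (xbar t) (fun x => F x t)
  (fun v => \col_i two_step (pl t) (be t) (fun l => v l 0) i).
Proof.
move=> Ot; apply: is_diff_mx => i j; rewrite ord1.
have -> : (fun y => F y t i 0) =
    (fun y => scaling (fun l => y l 0) (ce t) (ae t) (be t) i).
  by apply/funext => y; rewrite sinkhorn_map_entry //; exact: b_gt0.
apply: is_diff_ext (@is_diff_scaling R n m _ (xbar t) (fun y l => y l 0)
  (fun v l => v l 0) (fun=> ce t) (fun _ _ _ => 0) (fun=> ae t)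
  (fun _ _ => 0) (fun=> be t) (fun _ _ => 0) i m0 (b_gt0 Ot) (a_gt0 Ot i)
  (fun l => is_diff_coord _ l) (fun _ _ => is_diff_const _ _)
  (fun=> is_diff_const _ _) (fun=> is_diff_const _ _)) _ => v.
rewrite mxE xbar_entries // dscaling_two_step [X in _ + X](_ : _ = 0) ?addr0 //.
exact: dscaling0.
Qed.

Let is_diff_F_t t : Omega t -> is_diff t (fun s => F (xbar t) s)
  (fun v => \col_i dscaling (pl t) (ae t) (be t) (fun=> 0)
              (dce t v) (dae t v) (dbe t v) i).
Proof.
move=> Ot; apply: is_diff_mx => i j; rewrite ord1.
have near_Omega : \forall s \near t, Omega s by exact: open_nbhs_nbhs.
apply: (@is_diff_near_eq _ _ _ _
    (fun s => scaling (fun l => xbar t l 0) (ce s) (ae s) (be s) i)).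
  apply: filterS near_Omega => s Os.
  by rewrite /F sinkhorn_map_entry //; exact: b_gt0.
have H := @is_diff_scaling R n m _ t (fun _ l => xbar t l 0)
  (fun _ _ => 0) ce (dce t) ae (dae t) be (dbe t) i m0 (b_gt0 Ot) (a_gt0 Ot i)
  (fun=> is_diff_const _ _) (fun l k => (Hc l k).1 t Ot)
  (fun l => (Ha l).1 t Ot) (fun k => (Hb k).1 t Ot).
apply: (is_diff_ext H) => v.
by rewrite mxE xbar_entries.
Qed.

Let is_diff_P_x t : Omega t -> is_diff (xbar t) (fun x => P x t)
  (fun v => \matrix_(i, j) dcoupling (pl t) (be t) (fun l => v l 0)
     (fun _ _ => 0) (fun=> 0) i j).
Proof.
move=> Ot; apply: is_diff_mx => i j.
have -> : (fun y => P y t i j) =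
    (fun y => coupling (fun l => y l 0) (ce t) (be t) i j).
  by apply/funext => y; rewrite /P sinkhorn_plan_entry.
apply: is_diff_ext (@is_diff_coupling R n m _ (xbar t) (fun y l => y l 0)
  (fun v l => v l 0) (fun=> ce t) (fun _ _ _ => 0) (fun=> be t) (fun _ _ => 0)
  i j (b_gt0 Ot j) (fun l => is_diff_coord _ l)
  (fun _ _ => is_diff_const _ _) (fun=> is_diff_const _ _)) _ => v.
by rewrite mxE xbar_entries.
Qed.

Let is_diff_P_t t : Omega t -> is_diff t (fun s => P (xbar t) s)
  (fun v => \matrix_(i, j) dcoupling (pl t) (be t) (fun=> 0)
     (dce t v) (dbe t v) i j).
Proof.
move=> Ot; apply: is_diff_mx => i j.
have -> : (fun s => P (xbar t) s i j) =
    (fun s => coupling (fun l => xbar t l 0) (ce s) (be s) i j).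
  by apply/funext => y; rewrite /P sinkhorn_plan_entry.
apply: is_diff_ext (@is_diff_coupling R n m _ t (fun _ l => xbar t l 0)
  (fun _ _ => 0) ce (dce t) be (dbe t) i j (b_gt0 Ot j)
  (fun=> is_diff_const _ _) (fun l k => (Hc l k).1 t Ot)
  (fun k => (Hb k).1 t Ot)) _ => v.
by rewrite mxE xbar_entries.
Qed.

Let A_mul t (v : 'cV[R]_n) i : Omega t ->
  (A t *m v) i 0 = two_step (pl t) (be t) (fun l => v l 0) i.
Proof.
move=> Ot; rewrite jacobian_matrix_mul.
by have [_ ->] := is_diff_F_x Ot; rewrite mxE.
Qed.

(** [a_i A_il] is the sum over [j] of [P_ij P_lj / b_j], symmetric in [i] and
    [l]. *)
Lemma diagonalizable_subA t : Omega t -> diagonalizable (1%:M - A t).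
Proof.
move=> Ot; apply: (@detailed_balance_diagonalizable _ _ _ (ae t)).
  exact: a_gt0.
have AE i l : ae t i * A t i l = \sum_j pl t i j * (pl t l j / be t j).
  have -> : A t i l = (A t *m delta_mx l (0 : 'I_1)) i 0.
    by rewrite -colE [RHS]mxE.
  rewrite A_mul // /two_step rowE // mulrA divff ?gt_eqF ?a_gt0 // mul1r.
  apply: eq_bigr => j _; congr (_ * _); rewrite (bigD1 l) //= big1 ?addr0.
    by rewrite mxE !eqxx mulr1.
  by move=> k kl; rewrite mxE (negPf kl) mulr0.
have ME i l : (1%:M - A t) i l = (i == l)%:R - A t i l.
  by rewrite mxE [X in X + _]mxE [X in _ + X]mxE.
move=> i l; rewrite !ME !mulrBr !AE; congr (_ - _).
  by rewrite [l == i]eq_sym; case: eqP => [->|_] //; rewrite !mulr0.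
by apply: eq_bigr => j _; rewrite mulrCA mulrA mulrCA mulrA.
Qed.

Let N t := spectral_pinv (1%:M - A t).

(** The candidate for the limit of the derivatives of the iterates: it solves
    the differentiated fixed-point equation modulo constant vectors. *)
Let Jv t v : 'cV[R]_n := N t *m 'd (fun s => F (xbar t) s) t v.
Let J v t i := Jv t v i 0.

Let J_spec v t : Omega t -> forall i i',
  dscaling (pl t) (ae t) (be t) (J v t) (dce t v) (dae t v) (dbe t v) i
    - J v t i =
  dscaling (pl t) (ae t) (be t) (J v t) (dce t v) (dae t v) (dbe t v) i'
    - J v t i'.
Proof.
move=> Ot.
move=> i i'.
pose z : 'cV[R]_n := (1%:M - A t) *m Jv t v - 'd (fun s => F (xbar t) s) t v.
have Mz : (1%:M - A t) *m z = 0.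
  by apply/spectral_pinv_solves/spectral_pinvP/diagonalizable_subA.
have zE k : z k 0 = J v t k -
    dscaling (pl t) (ae t) (be t) (J v t) (dce t v) (dae t v) (dbe t v) k.
  have sub3 (x y w : 'cV[R]_n) : (x - y - w) k 0 = x k 0 - y k 0 - w k 0.
    by rewrite !mxE.
  rewrite /z mulmxBl mul1mx sub3 A_mul //.
  have [_ ->] := is_diff_F_t Ot.
  rewrite [X in _ - X]mxE [in RHS]dscaling_two_step.
  by rewrite [X in _ = _ + X]opprD [RHS]addrA.
have Az : two_step (pl t) (be t) (fun l => z l 0) =1 (fun l => z l 0).
  move=> k; rewrite -A_mul //; apply/esym/eqP; rewrite -subr_eq0; apply/eqP.
  have sub2 (x y : 'cV[R]_n) : (x - y) k 0 = x k 0 - y k 0 by rewrite !mxE.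
  by have /colP/(_ k) := Mz; rewrite mulmxBl mul1mx sub2 [RHS]mxE.
have := two_step_coupling_fixed n0 m0 (b_gt0 Ot) Az i i'.
by rewrite !zE; lra.
Qed.

Let dP k t v i j :=
  dcoupling (pe k t) (be t) (dxe k t v) (dce t v) (dbe t v) i j.
Let dPhat t v i j :=
  dcoupling (pl t) (be t) (J v t) (dce t v) (dbe t v) i j.

Let lin_cvg_dP t v i j : Omega t ->
  lin_cvg t (fun k s => dP k s v i j) (fun s => dPhat s v i j).
Proof.
move=> Ot; exact: (lin_cvg_dicoupling n0 m0 Omega_open Hc Ha Hb Hx0
  a_gt0 b_gt0 ab1 Ot (J_spec v)).
Qed.

Let C1_P_ k : C1_with Omega (P_ k) (fun t v => \matrix_(i, j) dP k t v i j).
Proof.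
apply: C1_with_mx => i j.
have -> : (fun t v => (\matrix_(i, j) dP k t v i j) i j) =
    (fun t v => dP k t v i j).
  by apply/funext => t; apply/funext => v; rewrite mxE.
apply: (C1_with_eq_on (f := fun t => pe k t i j)) => //.
  by move=> t; rewrite inE => Ot; rewrite P_E.
exact: (C1_with_icoupling m0 Hc Ha Hb Hx0 a_gt0 b_gt0).
Qed.

Let C1_Phat : C1_with Omega Phat (fun t v => \matrix_(i, j) dPhat t v i j).
Proof.
apply: C1_with_mx => i j.
have -> : (fun t v => (\matrix_(i, j) dPhat t v i j) i j) =
    (fun t v => dPhat t v i j).
  by apply/funext => t; apply/funext => v; rewrite mxE.
apply: (C1_with_eq_on (f := fun t => pl t i j)) => //.
  by move=> t; rewrite inE => Ot; rewrite PhatE.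
apply: (C1_with_limit Omega_open (f := fun k t => pe k t i j)
  (df := fun k t v => dP k t v i j)).
- by move=> k; exact: (C1_with_icoupling m0 Hc Ha Hb Hx0 a_gt0 b_gt0).
- move=> t Ot; apply: (lin_cvg_cvg (u := fun k s => pe k s i j)
    (f := fun s => pl s i j)).
  exact: (lin_cvg_icoupling n0 m0 Omega_open Hc Ha Hb Hx0 a_gt0 b_gt0 ab1 Ot).
- by move=> t v Ot; exact: lin_cvg_dP.
Qed.

Lemma C1_on_plan_iterate k : C1_on Omega (P_ k).
Proof. exact: C1_with_on (C1_P_ k). Qed.

Lemma C1_on_eot_plan : C1_on Omega Phat.
Proof. exact: C1_with_on C1_Phat. Qed.

Let dP_entry k t l i j : Omega t ->
  derivative_tensor (P_ k) t 0 l i j = dP k t (delta_mx l 0) i j.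
Proof.
move=> Ot; rewrite mxE.
by have [_ ->] := (C1_P_ k).1 t Ot; rewrite mxE.
Qed.

Let dPhat_entry t l i j : Omega t ->
  derivative_tensor Phat t 0 l i j = dPhat t (delta_mx l 0) i j.
Proof.
move=> Ot; rewrite mxE.
by have [_ ->] := C1_Phat.1 t Ot; rewrite mxE.
Qed.

(** The two terms of the formula are the two halves of the total differential of
    the coupling, along [J] and along the parameter; they add up because
    [dcoupling] is linear in the differentials. *)
Lemma derivative_eot_plan t : Omega t ->
  derivative_tensor Phat t =
  tensor_mul (derivative_tensor (fun x => P x t) (xbar t)) (N t *m B t)
    + derivative_tensor (fun s => P (xbar t) s) t.
Proof.
move=> Ot; apply/rowP => l; apply/matrixP => i j.
rewrite dPhat_entry //.
have add1 (T U : tensor3 R n m p) : (T + U) 0 l = T 0 l + U 0 l by rewrite mxE.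
have add2 (S T : 'M[R]_(n, m)) : (S + T) i j = S i j + T i j by rewrite mxE.
rewrite add1 add2 tensor_mul_derivative colE -mulmxA -colE.
rewrite jacobian_matrix_col.
rewrite -/(Jv t (delta_mx l 0)) [derivative_tensor _ _ 0 l]mxE.
have [_ ->] := is_diff_P_x Ot.
have [_ ->] := is_diff_P_t Ot.
rewrite !mxE /dPhat /dcoupling -mulrDr; congr (_ * _).
rewrite mul0r !subr0 addr0 sub0r.
have -> : \sum_l0 pl t l0 j / be t j *
      (J (delta_mx l 0) t l0 - dce t (delta_mx l 0) l0 j) =
    \sum_l0 pl t l0 j / be t j * (J (delta_mx l 0) t l0 - 0) +
    \sum_l0 pl t l0 j / be t j * (0 - dce t (delta_mx l 0) l0 j).
  by rewrite -big_split /=; apply: eq_bigr => k _; ring.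
by rewrite /J; ring.
Qed.

Lemma linear_rate_plan_derivative : linear_rate_loc_unif Omega
  (fun k => derivative_tensor (P_ k)) (derivative_tensor Phat).
Proof.
move=> t0 Ot0.
have [c [r [c0 r0 r1 H]]] := lin_cvg_fin
  (I := ('I_p * 'I_n * 'I_m)%type)
  (u := fun q k t => dP k t (delta_mx q.1.1 0) q.1.2 q.2)
  (f := fun q t => dPhat t (delta_mx q.1.1 0) q.1.2 q.2)
  (fun q => lin_cvg_dP (delta_mx q.1.1 0) q.1.2 q.2 Ot0).
have near_Omega : \forall t \near t0, Omega t by exact: open_nbhs_nbhs.
exists [set t | Omega t /\ forall (q : 'I_p * 'I_n * 'I_m) k,
  `|dP k t (delta_mx q.1.1 0) q.1.2 q.2 -
    dPhat t (delta_mx q.1.1 0) q.1.2 q.2| <= c * r ^+ k].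
split; first by apply: filterS2 near_Omega H => t.
  by move=> t [].
exists c, r; split=> // t k [Ot Ht].
have cr0 : 0 <= c * r ^+ k by rewrite mulr_ge0 ?exprn_ge0 ?ltW.
apply: (tensor_norm_sub_le cr0 (fun l i j => dP_entry k l i j Ot)
  (fun l i j => dPhat_entry l i j Ot)) => l i j.
exact: (Ht (l, i, j) k).
Qed.

Lemma cvg_plan_derivative t : Omega t ->
  (fun k => derivative_tensor (P_ k) t) @ \oo --> derivative_tensor Phat t.
Proof.
move=> Ot; apply: (cvg_tensor_entries (fun k l i j => dP_entry k l i j Ot)
  (fun l i j => dPhat_entry l i j Ot)) => l i j.
exact: (lin_cvg_cvg (u := fun k s => dP k s (delta_mx l 0) i j)
  (f := fun s => dPhat s (delta_mx l 0) i j) (lin_cvg_dP _ i j Ot)).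
Qed.

End SinkhornDerivatives.

Theorem theorem3p3 (R : realType) (n m p : nat) (Omega : set 'cV[R]_p)
    (C : 'cV[R]_p -> 'M[R]_(n, m)) (a : 'cV[R]_p -> 'cV[R]_n)
    (b : 'cV[R]_p -> 'cV[R]_m) (eps : 'cV[R]_p -> R)
    (x0 : 'cV[R]_p -> 'cV[R]_n)
    (Omega_open : open Omega) (Omega_connected : connected Omega)
    (C_C2 : C2_on Omega C) (a_C2 : C2_on Omega a) (b_C2 : C2_on Omega b)
    (eps_C2 : C2_on Omega eps) (x0_C2 : C2_on Omega x0)
    (a_simplex : forall t, Omega t -> simplex (a t))
    (a_gt0 : forall t, Omega t -> forall i, 0 < a t i 0)
    (b_simplex : forall t, Omega t -> simplex (b t))
    (b_gt0 : forall t, Omega t -> forall j, 0 < b t j 0)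
    (eps_gt0 : forall t, Omega t -> 0 < eps t) :
  let F := fun (x : 'cV[R]_n) t => sinkhorn_map (C t) (a t) (b t) (eps t) x in
  let P := fun (x : 'cV[R]_n) t => sinkhorn_plan (C t) (b t) (eps t) x in
  let Phat := fun t => eot_plan (C t) (a t) (b t) (eps t) in
  let x_ := fun (k : nat) t => iter k (fun x => F x t) (x0 t) in
  let xbar := fun t => lim (x_ ^~ t @ \oo) in
  let P_ := fun (k : nat) t => P (x_ k t) t in
  let A := fun t => jacobian_matrix (fun x => F x t) (xbar t) in
  let B := fun t => jacobian_matrix (fun s => F (xbar t) s) t in
  let dPdx := fun t => derivative_tensor (fun x => P x t) (xbar t) in
  let dPdt := fun t => derivative_tensor (fun s => P (xbar t) s) t in
  (* the objects named in the statement are well defined *)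
  (forall t, Omega t ->
     [/\ eot_argmin (C t) (a t) (b t) (eps t) = [set Phat t],
         x_ ^~ t @ \oo --> xbar t &
         diagonalizable (1%:M - A t)]) /\
  (* (1) *)
  (C1_on Omega Phat /\
   forall t, Omega t ->
     derivative_tensor Phat t =
       tensor_mul (dPdx t) (spectral_pinv (1%:M - A t) *m B t) + dPdt t) /\
  (* (2) *)
  [/\ forall k, C1_on Omega (P_ k),
      linear_rate_loc_unif Omega (fun k => derivative_tensor (P_ k))
        (derivative_tensor Phat) &
      forall t, Omega t ->
        (fun k => derivative_tensor (P_ k) t) @ \oo
          --> derivative_tensor Phat t].
Proof.
move=> F P Phat x_ xbar P_ A B dPdx dPdt.
have [[s Os]|Omega0] := pselect (exists s, Omega s); last first.
  have {}Omega0 t : ~ Omega t by move=> Ot; apply: Omega0; exists t.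
  split; first by move=> t /Omega0.
  split; first by split; [split=> [t|v t] /Omega0|move=> t /Omega0].
  split; first by move=> k; split=> [t|v t] /Omega0.
    by move=> t /Omega0.
  by move=> t /Omega0.
have n0 := simplex_dim_gt0 (a_simplex s Os).
have m0 := simplex_dim_gt0 (b_simplex s Os).
have ab1 t : Omega t -> \sum_i a t i 0 = \sum_j b t j 0.
  by move=> Ot; have [_ ->] := a_simplex t Ot; have [_ ->] := b_simplex t Ot.
have [C_C1 _] := C_C2; have [a_C1 _] := a_C2; have [b_C1 _] := b_C2.
have [eps_C1 _] := eps_C2; have [x0_C1 _] := x0_C2.
split=> [t Ot|].
  split.
  - exact: (eot_argminE Omega_open C_C1 a_C1 b_C1 eps_C1 x0_C1 ab1
      a_gt0 b_gt0 eps_gt0 n0 m0).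
  - exact: (cvg_sinkhorn Omega_open C_C1 a_C1 b_C1 eps_C1 x0_C1 ab1
      a_gt0 b_gt0 eps_gt0 n0 m0).
  - exact: (diagonalizable_subA Omega_open C_C1 a_C1 b_C1 eps_C1 x0_C1 ab1
      a_gt0 b_gt0 eps_gt0 n0 m0).
split.
  split; first exact: (C1_on_eot_plan Omega_open C_C1 a_C1 b_C1 eps_C1 x0_C1 ab1
      a_gt0 b_gt0 eps_gt0 n0 m0).
  move=> t Ot; exact: (derivative_eot_plan Omega_open C_C1 a_C1 b_C1 eps_C1
      x0_C1 ab1 a_gt0 b_gt0 eps_gt0 n0 m0).
split.
- move=> k; exact: (C1_on_plan_iterate Omega_open C_C1 a_C1 b_C1 eps_C1 x0_C1
    a_gt0 b_gt0 eps_gt0 m0).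
- exact: (linear_rate_plan_derivative Omega_open C_C1 a_C1 b_C1 eps_C1 x0_C1 ab1
    a_gt0 b_gt0 eps_gt0 n0 m0).
move=> t Ot; exact: (cvg_plan_derivative Omega_open C_C1 a_C1 b_C1 eps_C1 x0_C1
  ab1 a_gt0 b_gt0 eps_gt0 n0 m0).
Qed.
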